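(* Let $G$ be a countable discrete group, let $X$ be a compact Hausdorff space, and let $\alpha:G\curvearrowright X$ be a free action by homeomorphisms. Let $n \geq 1$ and let $a,b\in (D_n\otimes C(X))_+$. The following are equivalent: (i) $a\preccurlyeq b$; (ii) there exists a sequence $(t_k)_{k=1}^\infty$ in $\mathcal{RN}_{M_n\otimes (C(X)\rtimes_\alpha G)}(D_n\otimes C(X))$ such that $\lim_{k\to\infty}\|t_k^*bt_k-a\|=0$; (iii) for every $\epsilon>0$ there exist $\delta>0$ and $t\in\mathcal{RN}_{M_n\otimes (C(X)\rtimes_\alpha G)}(D_n\otimes C(X))$ such that $t^*(b-\delta)_+t=(a-\epsilon)_+$.
   Context: $M_n$ is the algebra of complex $n\times n$ matrices and $D_n\subseteq M_n$ the subalgebra of diagonal matrices. $C(X)\rtimes_\alpha G$ is the reduced crossed product. For a $C^*$-algebra $A$ with $C^*$-subalgebra $D$, $\mathcal{RN}_A(D):=\{a\in A: a^*Da\subseteq D\}$ is the set of $r$-normalizers of $D$ in $A$. For a positive element $c$ and $\eta>0$, $(c-\eta)_+$ is defined by functional calculus with the function $\lambda\mapsto\max(\lambda-\eta,0)$. For $f\in C(X)$, $\mathrm{supp}^\circ(f):=\{x\in X: f(x)\neq 0\}$. The relation $\preccurlyeq$: for compact sets $F_1,\dots,F_n\subseteq X$ and open sets $V_1,\dots,V_m\subseteq X$, write $(F_1,\dots,F_n)\prec(V_1,\dots,V_m)$ if there are open sets $U_{i,j}\subseteq X$, group elements $s_{i,j}\in G$, and indices $k_{i,j}\in\{1,\dots,m\}$,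 for $i=1,\dots,n$ and $j=1,\dots,J_i$, such that (1) $F_i\subseteq U_{i,1}\cup\dots\cup U_{i,J_i}$ for each $i$, and (2) the sets $s_{i,j}U_{i,j}\times\{k_{i,j}\}$ (over all $i=1,\dots,n$, $j=1,\dots,J_i$) are pairwise disjoint subsets of $\coprod_{l=1}^m V_l\times\{l\}$. For $a=\mathrm{diag}(a_1,\dots,a_n)\in(D_n\otimes C(X))_+$ and $b=\mathrm{diag}(b_1,\dots,b_m)\in(D_m\otimes C(X))_+$, write $a\preccurlyeq b$ if $(F_1,\dots,F_n)\prec(\mathrm{supp}^\circ(b_1),\dots,\mathrm{supp}^\circ(b_m))$ for every tuple of compact sets $F_1,\dots,F_n$ with $F_i\subseteq\mathrm{supp}^\circ(a_i)$ for all $i$. *)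

(* Defs.v *)
From HB Require Import structures.
From mathcomp Require Import all_boot all_order all_algebra.
From mathcomp Require Import all_classical all_reals all_analysis.
From mathcomp Require Import complex summability ring lra.
Import Order.TTheory GRing.Theory Num.Theory.
Import numFieldNormedType.Exports.

Set Implicit Arguments.
Unset Strict Implicit.
Unset Printing Implicit Defensive.

Local Open Scope classical_set_scope.
Local Open Scope ring_scope.

(* The complex numbers with their norm topology: MathComp-Analysis declares no
   topology on R[i], so that of the field over itself is transferred here. *)
Definition Cx (R : realType) : Type := R[i].
HB.instance Definition _ (R : realType) := Num.ClosedField.copy (Cx R) R[i].
HB.instance Definition _ (R : realType) := NormedModule.copy (Cx R) (Cx R)^o.

Section complex_norm.
Variable R : realType.
Implicit Types z w : Cx R.

(* `|z| lives in R[i]; this is the same number in R. *)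
Definition cnorm z : R := complex.Re `|z|.

Lemma cnormE z : ((cnorm z)%:C)%C = `|z|.
Proof. by rewrite RRe_real// normr_real. Qed.

Lemma cnorm_ge0 z : 0 <= cnorm z.
Proof. by rewrite -ler0c cnormE. Qed.

Lemma cnorm0 : cnorm 0 = 0.
Proof. by rewrite /cnorm normr0. Qed.

Lemma cnormM z w : cnorm (z * w) = cnorm z * cnorm w.
Proof. by apply: complexI; rewrite rmorphM/= !cnormE normrM. Qed.

Lemma cnormD z w : cnorm (z + w) <= cnorm z + cnorm w.
Proof. by rewrite -lecR rmorphD/= !cnormE ler_normD. Qed.

Lemma cnormD_sqr z w :
  cnorm (z + w) ^+ 2 <= 2 * cnorm z ^+ 2 + 2 * cnorm w ^+ 2.
Proof.
apply: (@le_trans _ _ ((cnorm z + cnorm w) ^+ 2)).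
  by rewrite ler_pXn2r ?nnegrE ?addr_ge0 ?cnorm_ge0// cnormD.
set x := cnorm z; set y := cnorm w.
rewrite -subr_ge0 (_ : _ - _ = (x - y) ^+ 2) ?sqr_ge0//.
by ring.
Qed.

Lemma lip_continuous (f : Cx R -> R) :
  (forall z w, `|f z - f w| <= cnorm (z - w)) -> continuous f.
Proof.
move=> fL z; apply/cvgrPdist_lt; first exact: (nbhs_filter z).
move=> e e0; exists (e%:C)%C; first by rewrite /= ltcR.
move=> w; rewrite /ball_/= -cnormE ltcR.
exact: le_lt_trans.
Qed.

Lemma cnorm_continuous : continuous (@cnorm : Cx R -> R).
Proof.
apply: lip_continuous => z w; rewrite ler_norml; apply/andP; split.
  rewrite lerBrDr addrC lerBlDr (_ : cnorm (z - w) = cnorm (w - z)).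
    by rewrite -[X in cnorm X <= _](subrK z) addrC cnormD.
  by rewrite /cnorm distrC.
by rewrite lerBlDr -[X in cnorm X <= _](subrK w) cnormD.
Qed.

Lemma Re_continuous : continuous (@complex.Re R : Cx R -> R).
Proof.
apply: lip_continuous => -[a b] [c d].
by rewrite -lecR cnormE; exact: (normc_ge_Re ((a - c) +i* (b - d))%C).
Qed.

Lemma complex_of_real_continuous : continuous (fun x : R => (x%:C)%C : Cx R).
Proof.
move=> x; apply/cvgrPdist_lt => e.
rewrite ltcE/= => /andP[/eqP ei e0].
exists (complex.Re e) => // y; rewrite /ball_/= => xy.
 rewrite -rmorphB/= -cnormE /cnorm normc_def /=.
rewrite expr0n addr0 sqrtr_sqr ltcE/=.
by rewrite xy ei eqxx.
Qed.

End complex_norm.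

Section l2_space.
Variables (R : realType) (I : choiceType).
Local Notation C := (Cx R).

Definition sqsum (xi : I -> C) : \bar R :=
  \esum_(i in [set: I]) ((cnorm (xi i)) ^+ 2)%:E.

Definition sqsummable : {pred I -> C} := [pred xi | `[< (sqsum xi < +oo)%E >]].

Lemma sqsum_ge0 xi : (0 <= sqsum xi)%E.
Proof. by apply: esum_ge0 => i _; rewrite lee_fin sqr_ge0. Qed.

Lemma sqsum_le (c : R) xi eta : 0 <= c ->
    (forall i, cnorm (xi i) ^+ 2 <= c * cnorm (eta i) ^+ 2) ->
  (sqsum xi <= c%:E * sqsum eta)%E.
Proof.
move=> c0 le_xi_eta; apply: ge_ereal_sup => _ [A [finA _] <-].
apply: (@le_trans _ _ (c%:E * \sum_(i \in A) ((cnorm (eta i)) ^+ 2)%:E)%E).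
  rewrite ge0_mule_fsumr; last by move=> i; rewrite lee_fin sqr_ge0.
  by apply: lee_fsum => // i _; rewrite -EFinM lee_fin.
rewrite lee_wpmul2l ?lee_fin//; apply: ereal_sup_ubound.
by exists A.
Qed.

Lemma sqsumD xi eta :
  (sqsum (xi + eta)%R <= 2%:E * sqsum xi + 2%:E * sqsum eta)%E.
Proof.
apply: (@le_trans _ _ (\esum_(i in [set: I])
  ((2 * cnorm (xi i) ^+ 2)%:E + (2 * cnorm (eta i) ^+ 2)%:E))%E).
  by apply: le_esum => i _; rewrite -EFinD lee_fin cnormD_sqr.
have ge0 (f : I -> C) i : (0 <= (2 * cnorm (f i) ^+ 2)%:E)%E.
  by rewrite lee_fin mulr_ge0 ?sqr_ge0.
rewrite esumD//.
have H (f : I -> C) : (\esum_(i in [set: I]) (2 * cnorm (f i) ^+ 2)%:E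
    <= 2%:E * sqsum f)%E.
  apply: ge_ereal_sup => _ [A [finA _] <-].
  apply: (@le_trans _ _ (2%:E * \sum_(i \in A) ((cnorm (f i)) ^+ 2)%:E)%E).
    rewrite ge0_mule_fsumr; last by move=> i; rewrite lee_fin sqr_ge0.
    by apply: lee_fsum => // i _; rewrite -EFinM.
  by rewrite lee_wpmul2l ?lee_fin//; apply: ereal_sup_ubound; exists A.
exact: leeD.
Qed.

Lemma sqsummable_submod : submod_closed sqsummable.
Proof.
split=> [|a u v /asboolP uoo /asboolP voo]; apply/asboolP.
  rewrite /sqsum esum1// => i _.
  by rewrite cnorm0 expr0n.
have auoo : (sqsum (a *: u) < +oo)%E.
  apply: (@le_lt_trans _ _ ((cnorm a ^+ 2)%:E * sqsum u)%E).
    by apply: sqsum_le => [|i]; rewrite ?sqr_ge0// -exprMn -cnormM.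
  by rewrite lte_mul_pinfty ?lee_fin ?sqr_ge0.
apply: (le_lt_trans (sqsumD _ _)).
by apply: lte_add_pinfty; rewrite lte_mul_pinfty// lee_fin.
Qed.

HB.instance Definition _ :=
  GRing.isSubmodClosed.Build C (I -> C) sqsummable sqsummable_submod.

(* The Hilbert space l^2(I) of square-summable complex families. *)
Record l2 := L2 { l2val :> I -> C ; l2valP : l2val \in sqsummable }.
HB.instance Definition _ := [isSub for l2val].
HB.instance Definition _ := [Choice of l2 by <:].
HB.instance Definition _ := [SubChoice_isSubLmodule of l2 by <:].

Implicit Types xi eta : l2.

Lemma l2P xi eta : (forall i, xi i = eta i) -> xi = eta.
Proof. by move=> e; apply/val_inj/funext. Qed.

Lemma l2D xi eta i : (xi + eta) i = xi i + eta i.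
Proof. by []. Qed.

Lemma l2Z a xi i : (a *: xi) i = a * xi i.
Proof. by []. Qed.

Lemma sqsum_fin xi : (sqsum xi \is a fin_num)%E.
Proof.
rewrite ge0_fin_numE ?sqsum_ge0//.
by have /asboolP := l2valP xi.
Qed.

Definition l2norm xi : R := Num.sqrt (fine (sqsum xi)).

(* The sum over I is the limit of the net of finite partial sums; the inner
   product is linear in its first argument. *)
Definition inner xi eta : C := summability.sum (fun i => xi i * (eta i)^* : C).

Lemma l2norm_ge0 xi : 0 <= l2norm xi.
Proof. exact: sqrtr_ge0. Qed.

Lemma l2norm0 : l2norm 0 = 0.
Proof.
rewrite /l2norm /sqsum esum1 ?sqrtr0// => i _.
by rewrite cnorm0 expr0n.
Qed.

Lemma l2norm_le (c : R) xi eta : 0 <= c ->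
  (sqsum xi <= (c ^+ 2)%:E * sqsum eta)%E -> l2norm xi <= c * l2norm eta.
Proof.
move=> c0 le_xi_eta.
rewrite /l2norm -[c in leRHS]ger0_norm// -sqrtr_sqr -sqrtrM ?sqr_ge0//.
rewrite ler_wsqrtr// -lee_fin EFinM !fineK ?sqsum_fin//.
Qed.

Lemma l2normN xi : l2norm (- xi) = l2norm xi.
Proof.
rewrite /l2norm; congr (Num.sqrt (fine _)); apply: eq_esum => i _.
by rewrite /cnorm normrN.
Qed.

Lemma l2normD_le xi eta : l2norm (xi + eta) <= 2 * l2norm xi + 2 * l2norm eta.
Proof.
rewrite -[leRHS]ger0_norm ?addr_ge0 ?mulr_ge0 ?l2norm_ge0//.
rewrite -sqrtr_sqr ler_wsqrtr//.
have := sqsumD xi eta.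
rewrite -[sqsum xi]fineK ?sqsum_fin// -[sqsum eta]fineK ?sqsum_fin//.
rewrite -[X in (X <= _)%E -> _](fineK (sqsum_fin (xi + eta))).
rewrite -!EFinM -EFinD lee_fin => /le_trans; apply.
have sq f : fine (sqsum (l2val f)) = l2norm f ^+ 2.
  by rewrite /l2norm sqr_sqrtr// fine_ge0 ?sqsum_ge0.
rewrite !sq; set x := l2norm xi; set y := l2norm eta.
have x0 : 0 <= x := l2norm_ge0 _; have y0 : 0 <= y := l2norm_ge0 _.
have xy := mulr_ge0 x0 y0; have xx := sqr_ge0 x; have yy := sqr_ge0 y.
nra.
Qed.

End l2_space.

Section bounded_operators.
Variables (R : realType) (I : choiceType).
Local Notation C := (Cx R).
Local Notation H := (l2 R I).

(* The C*-algebra B(l^2(I)) of bounded linear operators. *)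
Record bop := Bop {
  bopval :> H -> H ;
  bop_linear : linear bopval ;
  bop_bounded : exists M : R, forall xi, l2norm (bopval xi) <= M * l2norm xi }.

HB.instance Definition _ := gen_eqMixin bop.
HB.instance Definition _ := gen_choiceMixin bop.

Implicit Types S T U : bop.

Lemma bopP S T : S =1 T -> S = T.
Proof.
case: S T => [S Sl Sb] [T Tl Tb] /= /funext ST; subst T.
by congr Bop; exact: Prop_irrelevance.
Qed.

Lemma bop_pos_bound T :
  exists2 M : R, 0 <= M & forall xi, l2norm (T xi) <= M * l2norm xi.
Proof.
have [M MT] := bop_bounded T; exists (Num.max M 0).
  by rewrite le_max lexx orbT.
move=> xi; apply: (le_trans (MT xi)).
by rewrite ler_wpM2r ?l2norm_ge0// le_max lexx.
Qed.

Fact zero_linear : linear (fun _ : H => 0 : H).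
Proof. by move=> a x y; rewrite scaler0 addr0. Qed.
Fact zero_bounded :
  exists M : R, forall xi : H, l2norm (0 : H) <= M * l2norm xi.
Proof. by exists 0 => xi; rewrite l2norm0 mul0r. Qed.
Definition bop_zero := Bop zero_linear zero_bounded.

Fact one_linear : linear (fun x : H => x).
Proof. by []. Qed.
Fact one_bounded : exists M : R, forall xi : H, l2norm xi <= M * l2norm xi.
Proof. by exists 1 => xi; rewrite mul1r. Qed.
Definition bop_one := Bop one_linear one_bounded.

Fact opp_linear T : linear (fun x => - T x).
Proof. by move=> a x y; rewrite bop_linear opprD scalerN. Qed.
Fact opp_bounded T :
  exists M : R, forall xi, l2norm (- T xi) <= M * l2norm xi.
Proof.
by have [M MT] := bop_bounded T; exists M => xi; rewrite l2normN.
Qed.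
Definition bop_opp T := Bop (opp_linear T) (opp_bounded T).

Fact add_linear S T : linear (fun x => S x + T x).
Proof. by move=> a x y; rewrite !bop_linear scalerDr addrACA. Qed.
Fact add_bounded S T :
  exists M : R, forall xi, l2norm (S xi + T xi) <= M * l2norm xi.
Proof.
have [M MS] := bop_bounded S; have [N NT] := bop_bounded T.
exists (2 * M + 2 * N) => xi; apply: (le_trans (l2normD_le _ _)).
by rewrite [leRHS]mulrDl -!mulrA lerD// ler_pM2l.
Qed.
Definition bop_add S T := Bop (add_linear S T) (add_bounded S T).

Fact mul_linear S T : linear (fun x => S (T x)).
Proof. by move=> a x y; rewrite !bop_linear. Qed.
Fact mul_bounded S T :
  exists M : R, forall xi, l2norm (S (T xi)) <= M * l2norm xi.
Proof.
have [M M0 MS] := bop_pos_bound S; have [N NT] := bop_bounded T.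
exists (M * N) => xi; apply: (le_trans (MS _)).
by rewrite -mulrA ler_wpM2l.
Qed.
Definition bop_mul S T := Bop (mul_linear S T) (mul_bounded S T).

Fact bop_addA : associative bop_add.
Proof. by move=> S T U; apply: bopP => x; exact: addrA. Qed.
Fact bop_addC : commutative bop_add.
Proof. by move=> S T; apply: bopP => x; exact: addrC. Qed.
Fact bop_add0 : left_id bop_zero bop_add.
Proof. by move=> S; apply: bopP => x; exact: add0r. Qed.
Fact bop_addN : left_inverse bop_zero bop_opp bop_add.
Proof. by move=> S; apply: bopP => x; exact: addNr. Qed.

HB.instance Definition _ :=
  GRing.isZmodule.Build bop bop_addA bop_addC bop_add0 bop_addN.

Fact bop_mulA : associative bop_mul.
Proof. by move=> S T U; apply: bopP. Qed.
Fact bop_mul1 : left_id bop_one bop_mul.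
Proof. by move=> S; apply: bopP. Qed.
Fact bop_1mul : right_id bop_one bop_mul.
Proof. by move=> S; apply: bopP. Qed.
Fact bop_mulDl : left_distributive bop_mul bop_add.
Proof. by move=> S T U; apply: bopP. Qed.
Fact bop_mulDr : right_distributive bop_mul bop_add.
Proof.
move=> S T U; apply: bopP => x /=.
by have := bop_linear S 1 (T x) (U x); rewrite !scale1r.
Qed.

HB.instance Definition _ := GRing.Zmodule_isPzRing.Build bop
  bop_mulA bop_mul1 bop_1mul bop_mulDl bop_mulDr.

(* The adjoint of T is the unique S with <T xi, eta> = <xi, S eta>; the default
   value 0 is never used, since every bounded operator has an adjoint. *)
Definition adj T : bop :=
  xget (0 : bop)
    [set S : bop | forall xi eta, inner (T xi) eta = inner xi (S eta)].

Definition opnorm T : R :=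
  sup [set l2norm (T xi) | xi in [set xi | l2norm xi <= 1]].

End bounded_operators.

Section matrices_of_operators.
Variables (R : realType) (I : choiceType) (n : nat).

(* M_n (x) B(H) is realised as the n x n matrices over B(H). Such a matrix acts
   on H^n, and mxopnorm is the norm of that operator. *)
Definition mxadj (t : 'M[bop R I]_n) : 'M[bop R I]_n := (map_mx (@adj R I) t)^T.

Definition vnorm (xi : 'I_n -> l2 R I) : R :=
  Num.sqrt (\sum_i l2norm (xi i) ^+ 2).

Definition mxapply (t : 'M[bop R I]_n) (xi : 'I_n -> l2 R I) : 'I_n -> l2 R I :=
  fun i => \sum_j t i j (xi j).

Definition mxopnorm (t : 'M[bop R I]_n) : R :=
  sup [set vnorm (mxapply t xi) | xi in [set xi | vnorm xi <= 1]].

End matrices_of_operators.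

(* An action by homeomorphisms: taction_fun g is continuous with continuous
   inverse taction_fun g^-1. *)
Record taction (G : groupType) (X : topologicalType) := TAction {
  taction_fun :> G -> X -> X ;
  taction1 : forall x, taction_fun 1%g x = x ;
  tactionM : forall g h x,
    taction_fun (g * h)%g x = taction_fun g (taction_fun h x) ;
  taction_continuous : forall g, continuous (taction_fun g) }.

Definition free_taction (G : groupType) (X : topologicalType)
    (al : taction G X) : Prop :=
  forall g x, al g x = x -> g = 1%g.

Notation cfun R X := (continuousType X (Cx R)).

Section crossed_product.
Variables (R : realType) (G : groupType) (X : topologicalType).
Hypothesis Xcompact : compact [set: X].
Variable al : taction G X.
Local Notation C := (Cx R).
Local Notation H := (l2 R (G * X)%type).
Local Notation B := (bop R (G * X)%type).

Lemma cfun_bounded (f : cfun R X) :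
  exists2 M : R, 0 <= M & forall x, cnorm (f x) <= M.
Proof.
have cf : continuous (fun x => cnorm (f x)).
  move=> x; apply: (@continuous_comp _ _ _ f (@cnorm R)).
    exact: cts_fun.
  exact: cnorm_continuous.
have : compact ((fun x => cnorm (f x)) @` [set: X]).
  by apply: continuous_compact => //; exact: continuous_subspaceT.
move=> /compact_bounded[M [_ bM]]; exists (Num.max (M + 1) 0).
  by rewrite le_max lexx orbT.
move=> x; rewrite le_max; apply/orP; left.
apply: (le_trans (ler_norm _)).
by apply: (bM (M + 1)); [rewrite ltrDl|exists x].
Qed.

(* The regular representation of C(X) x| G on l^2(G, l^2(X)) = l^2(G x X)
   induced by the faithful representation of C(X) on l^2(X) by multiplication:
   (pi(f) xi)(s) = alpha_s^-1(f) xi(s) and (lambda_g xi)(s) = xi(g^-1 s), where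
   alpha_g(f)(x) = f(g^-1 x). *)
Section multiplication.
Variable f : cfun R X.

Lemma mulop_subproof (xi : H) :
  (fun p => f (al p.1 p.2) * xi p) \in @sqsummable R (G * X)%type.
Proof.
have [M M0 fM] := cfun_bounded f.
apply/asboolP; apply: (@le_lt_trans _ _ ((M ^+ 2)%:E * sqsum xi)%E).
  apply: sqsum_le => [|i]; rewrite ?sqr_ge0//.
  rewrite cnormM exprMn ler_wpM2r ?sqr_ge0//.
  by rewrite ler_pXn2r ?nnegrE ?cnorm_ge0.
rewrite lte_mul_pinfty ?lee_fin ?sqr_ge0//.
by have /asboolP := l2valP xi.
Qed.

Definition mulop_fun (xi : H) : H := L2 (mulop_subproof xi).

Fact mulop_linear : linear mulop_fun.
Proof.
move=> a x y; apply: l2P => p; rewrite l2D l2Z /= mulrDr.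
by rewrite mulrCA.
Qed.

Fact mulop_bounded :
  exists M : R, forall xi, l2norm (mulop_fun xi) <= M * l2norm xi.
Proof.
have [M M0 fM] := cfun_bounded f; exists M => xi.
apply: l2norm_le => //; apply: sqsum_le => [|i]; rewrite ?sqr_ge0//=.
rewrite cnormM exprMn ler_wpM2r ?sqr_ge0//.
by rewrite ler_pXn2r ?nnegrE ?cnorm_ge0.
Qed.

Definition mulop : B := Bop mulop_linear mulop_bounded.
End multiplication.

Section translation.
Variable g : G.

Lemma sqsum_trans (xi : G * X -> C) :
  sqsum (fun p => xi (g^-1 * p.1, p.2)%g) = sqsum xi.
Proof.
rewrite /sqsum; apply/esym.
apply: (@reindex_esum R _ _ [set: G * X] [set: G * X]
  (fun p => (g^-1 * p.1, p.2)%g)).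
split => // [[s x] [s' x'] _ _ /= [] /mulgI -> -> //|[s x] _ /=].
by exists (g * s, x)%g; rewrite //= mulKg.
Qed.

Lemma trans_subproof (xi : H) :
  (fun p => xi (g^-1 * p.1, p.2)%g) \in @sqsummable R (G * X)%type.
Proof.
by apply/asboolP; rewrite sqsum_trans; have /asboolP := l2valP xi.
Qed.

Definition trans_fun (xi : H) : H := L2 (trans_subproof xi).

Fact trans_linear : linear trans_fun.
Proof. by move=> a x y; exact: l2P. Qed.

Fact trans_bounded :
  exists M : R, forall xi, l2norm (trans_fun xi) <= M * l2norm xi.
Proof. by exists 1 => xi; rewrite mul1r /l2norm sqsum_trans. Qed.

Definition transop : B := Bop trans_linear trans_bounded.
End translation.

Definition algebraic_crossed_product : set B :=
  [set T | exists s : seq (cfun R X * G),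
     T = \sum_(p <- s) mulop p.1 * transop p.2].

(* The reduced crossed product: the norm closure of the above. *)
Definition crossed_product : set B :=
  [set T | forall e : R, 0 < e ->
     exists2 S, algebraic_crossed_product S & opnorm (T - S) < e].

Variable n : nat.

Definition mx_crossed_product : set 'M[B]_n :=
  [set t | forall i j, crossed_product (t i j)].

(* diag(f_1, ..., f_n) in D_n (x) C(X), as an element of M_n (x) (C(X) x| G). *)
Definition diagop (f : 'I_n -> cfun R X) : 'M[B]_n :=
  diag_mx (\row_i mulop (f i)).

Definition diag_subalgebra : set 'M[B]_n := range diagop.

Definition r_normalizers (A D : set 'M[B]_n) : set 'M[B]_n :=
  [set t | A t /\ forall d, D d -> D (mxadj t *m d *m t)].

End crossed_product.

Arguments mx_crossed_product R {G X} Xcompact al n _.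
Arguments diag_subalgebra R {G X} Xcompact al n _.

Section positive_functions.
Variables (R : realType) (X : topologicalType).

Definition osupp (f : X -> Cx R) : set X := [set x | f x != 0].

(* Functional calculus in C(X) is composition. For f >= 0 the values of f are
   real, so that Re changes nothing; it only makes the definition total. *)
Definition cutoff_fun (f : X -> Cx R) (eta : R) : X -> Cx R :=
  fun x => ((Num.max (complex.Re (f x) - eta) 0)%:C)%C.

Lemma cutoff_continuous (f : cfun R X) eta : continuous (cutoff_fun f eta).
Proof.
move=> x.
apply: (@continuous_comp _ _ _ (fun x => Num.max (complex.Re (f x) - eta) 0)
  (fun r : R => (r%:C)%C : Cx R)); last exact: complex_of_real_continuous.
apply: (@continuous_max _ _ (fun x => complex.Re (f x) - eta) (fun=> 0)).
  apply: (@continuousB _ _ _ (fun x => complex.Re (f x)) (fun=> eta)).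
    apply: (@continuous_comp _ _ _ f (@complex.Re R)); first exact: cts_fun.
    exact: Re_continuous.
  exact: cst_continuous.
exact: cst_continuous.
Qed.

Definition cutoff (f : cfun R X) (eta : R) : cfun R X :=
  mkcts (@cutoff_continuous f eta).

End positive_functions.

Section comparison.
Variables (G : groupType) (X : topologicalType) (al : taction G X).

(* (F_1, ..., F_n) < (V_1, ..., V_m). The index j ranges over the naturals below
   J i, and the coproduct of the V_l is a set of pairs (point, l). *)
Definition tuple_prec n m (F : 'I_n -> set X) (V : 'I_m -> set X) : Prop :=
  exists (J : 'I_n -> nat) (U : 'I_n -> nat -> set X) (s : 'I_n -> nat -> G)
         (k : 'I_n -> nat -> 'I_m),
    let idx := [set p : 'I_n * nat | (p.2 < J p.1)%N] in
    let W p := (al (s p.1 p.2) @` U p.1 p.2) `*` [set k p.1 p.2] in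
    [/\ forall p, idx p -> open (U p.1 p.2),
        forall i, F i `<=` \bigcup_(j in [set j | (j < J i)%N]) U i j,
        forall p, idx p -> W p `<=` [set q | V q.2 q.1] &
        trivIset idx W].

Definition diag_precsim (R : realType) n m
    (a : 'I_n -> cfun R X) (b : 'I_m -> cfun R X) : Prop :=
  forall F : 'I_n -> set X,
    (forall i, compact (F i)) -> (forall i, F i `<=` osupp (a i)) ->
    tuple_prec F (fun l => osupp (b l)).

End comparison.

(* Main.v *)
From HB Require Import structures.
Require Import Defs.
From mathcomp Require Import all_boot all_order all_algebra.
From mathcomp Require Import all_classical all_reals all_analysis.
From mathcomp Require Import finmap complex summability ring lra.
Import Order.TTheory GRing.Theory Num.Theory.
Import numFieldNormedType.Exports.

Set Implicit Arguments.
Unset Strict Implicit.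
Unset Printing Implicit Defensive.

Local Open Scope classical_set_scope.
Local Open Scope ring_scope.

(** An operator T on l^2(G x X) that comes from the crossed product moves no
    mass between different points of X, and is a matrix indexed by the orbit
    of x on each fibre G x {x}: its entry from (r, x) to (s, x) depends only
    on s r^-1 and on the point s x, continuously in the latter. So a matrix t
    over the crossed product is, orbit by orbit, a matrix whose rows and
    columns are indexed by pairs (index in 'I_n, point of the orbit).

    The relation defining r-normalizers then becomes combinatorial. If
    adj t d t is diagonal for all diagonal d, then two different columns of t
    are orthogonal even after multiplication by an arbitrary continuous
    function; since continuous functions separate points of a compact
    Hausdorff space, every row of t has at most one nonzero entry
    ([RN_row_unique]). Conversely a finite sum of translated functions
    lambda_s q whose translates s (supp q) are pairwise disjoint has this
    property and is an r-normalizer ([translates_RN]). This is exactly the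
    disjointness of the sets s U x {k} in the comparison relation.

    The three conditions are linked through an approximate form of (ii): for
    every e > 0 some r-normalizer t satisfies ||adj t b t - a|| < e.
    - From the approximate form to (i): adj t b t is a diagonal c close to a,
      so each c_j is nonzero on the given compact F_j. A nonzero value of c_j
      at z forces a group element g and an index i with b_i (g z) and the
      coefficient of t at (g z, i), (z, j) both nonzero
      ([nonzero_diag_support]). These are open conditions on z; finitely many
      pairs (i, g) cover F_j, and uniqueness in the rows makes the translates
      disjoint ([approx_diag_precsim]).
    - From (i) to (iii): apply (i) to the compact sets {a_i >= eps}, take a
      partition of unity h_ij subordinate to the cover, and sum the translates
      of the square roots of (a_i - eps)_+ h_ij / (b_k - delta)_+ (s x); delta
      exists because b_k (s x) is bounded below on the closed support of h_ij
      ([precsim_cutoff_sandwich]).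
    - From (iii) to the approximate form: the multiplier
      h = ((b - delta)_+ / b)^(1/2) is absorbed into t, since
      h b h = (b - delta)_+ and h t is again an r-normalizer
      ([RN_absorb_cutoff]); moreover (a - eps)_+ is within eps of a.

    Everything rests on adjoints of bounded operators on l^2, obtained from
    convergence of the inner product (by polarization), the Cauchy-Schwarz
    inequality and the density of finitely supported vectors. *)

(** * Norm and convergence in the complex numbers *)

Section complex_facts.
Variable R : realType.
Implicit Types z w : Cx R.

Lemma cnorm_conj z : cnorm z^* = cnorm z.
Proof. by rewrite /cnorm norm_conjC. Qed.

Lemma cnormC (r : R) : cnorm (r%:C)%C = `|r|.
Proof. by rewrite /cnorm normc_def /= expr0n addr0 sqrtr_sqr. Qed.

Lemma cnorm_eq0 z : cnorm z = 0 -> z = 0.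
Proof. by move=> z0; apply/eqP; rewrite -normr_eq0 -cnormE z0. Qed.

Lemma cnorm_sqr z : ((cnorm z ^+ 2)%:C)%C = z * z^*.
Proof. by rewrite rmorphXn/= cnormE normCK. Qed.

Lemma cvg_cnorm (T : Type) (F : set_system T) `{FF : Filter T F}
    (f : T -> Cx R) (l : Cx R) :
  (forall e : R, 0 < e -> F [set x | cnorm (l - f x) < e]) -> f @ F --> l.
Proof.
move=> H; apply/cvgrPdist_lt => e.
rewrite ltcE/= => /andP[/eqP ei e0].
near=> x; rewrite -cnormE ltcE/= ei eqxx/=.
by near: x; exact: H.
Unshelve. all: by end_near.
Qed.

Lemma cnorm_cvg_lt (T : Type) (F : set_system T) `{FF : Filter T F}
    (f : T -> Cx R) (l : Cx R) :
  f @ F --> l -> forall e : R, 0 < e -> F [set x | cnorm (l - f x) < e].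
Proof.
move=> /cvgrPdist_lt H e e0; have /H : 0 < (e%:C)%C :> Cx R by rewrite ltcR.
by apply: filterS => x; rewrite -cnormE ltcR.
Qed.

Lemma cnorm_arb_small z : (forall e : R, 0 < e -> cnorm z <= e) -> z = 0.
Proof.
move=> small; apply: cnorm_eq0; apply/eqP; rewrite eq_le cnorm_ge0 andbT.
by apply/ler_addgt0Pr => e e0; rewrite add0r small.
Qed.

Lemma cnormB z w : cnorm (z - w) = cnorm (w - z).
Proof. by rewrite /cnorm distrC. Qed.

End complex_facts.

(** * The inner product of l^2 *)

#[local] Existing Instance totally_filter.

Section l2_inner.
Variables (R : realType) (I : choiceType).
Local Notation C := (Cx R).
Local Notation H := (l2 R I).
Implicit Types (xi eta zeta : H) (J K : {fset I}).

Lemma sqsum_leP (f : I -> C) (c : \bar R) :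
  (sqsum f <= c)%E <->
  forall J, ((\sum_(i <- J) cnorm (f i) ^+ 2)%:E <= c)%E.
Proof.
split=> [le_c J|le_c].
  apply: le_trans le_c; apply: esum_ge; exists [set` J].
    by split=> //; exact: finite_fset.
  by rewrite -fsbig_seq ?fset_uniq// sumEFin.
apply: ge_ereal_sup => _ [A [/finite_fsetP[J ->] _] <-].
by rewrite -fsbig_seq ?fset_uniq// sumEFin.
Qed.

Lemma sqsumE xi : sqsum xi = (l2norm xi ^+ 2)%:E.
Proof.
by rewrite /l2norm sqr_sqrtr ?fine_ge0 ?sqsum_ge0// fineK ?sqsum_fin.
Qed.

Lemma fsum_le_l2norm xi J : \sum_(i <- J) cnorm (xi i) ^+ 2 <= l2norm xi ^+ 2.
Proof. by rewrite -lee_fin -sqsumE; move: J; apply/sqsum_leP. Qed.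

Lemma l2norm_sqr_le xi (c : R) :
  (forall J, \sum_(i <- J) cnorm (xi i) ^+ 2 <= c) -> l2norm xi ^+ 2 <= c.
Proof.
by move=> le_c; rewrite -lee_fin -sqsumE; apply/sqsum_leP => J; rewrite lee_fin.
Qed.

Lemma cnorm_le_l2norm xi i : cnorm (xi i) <= l2norm xi.
Proof.
rewrite -(@ler_pXn2r _ 2) ?nnegrE ?cnorm_ge0 ?l2norm_ge0//.
by have := fsum_le_l2norm xi [fset i]%fset; rewrite big_seq_fset1.
Qed.

Lemma fsum_approx xi (e : R) : 0 < e ->
  exists J, l2norm xi ^+ 2 - e < \sum_(i <- J) cnorm (xi i) ^+ 2.
Proof.
move=> e0; apply: contrapT => /forallNP no.
suff : l2norm xi ^+ 2 <= l2norm xi ^+ 2 - e by rewrite lerBrDr gerDl leNgt e0.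
by apply: l2norm_sqr_le => J; rewrite leNgt; apply/negP/no.
Qed.

Lemma fsum_sub (f : I -> R) J K : (forall i, 0 <= f i) -> (J `<=` K)%fset ->
  \sum_(i <- J) f i <= \sum_(i <- K) f i.
Proof.
move=> f0 JK; rewrite [leRHS](bigID (mem J))/=.
rewrite (_ : \sum_(i <- J) _ = \sum_(i <- K | i \in J) f i).
  by rewrite lerDl sumr_ge0.
rewrite -[RHS]big_filter; apply: perm_big; apply: uniq_perm.
- exact: fset_uniq.
- by rewrite filter_uniq ?fset_uniq.
- move=> i; rewrite mem_filter; case: (boolP (i \in J)) => //= iJ.
  by rewrite (fsubsetP JK).
Qed.

Lemma fsum_le_supp (f : I -> R) J K : (forall i, 0 <= f i) ->
  (forall i, i \notin J -> f i = 0) ->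
  \sum_(i <- K) f i <= \sum_(i <- J) f i.
Proof.
move=> f0 fJ; apply: (@le_trans _ _ (\sum_(i <- (J `|` K)%fset) f i)).
  exact/fsum_sub/fsubsetUr.
rewrite (@big_fset_incl _ _ _ _ J (J `|` K)%fset) ?fsubsetUl// => i _.
exact: fJ.
Qed.

Lemma partial_sumE (V : zmodType) (f : I -> V) J :
  partial_sum f J = \sum_(i <- J) f i.
Proof. by rewrite big_seq_fsetE. Qed.

Lemma near_totally (P : {fset I} -> Prop) J :
  (forall K, (J `<=` K)%fset -> P K) -> \forall K \near totally, P K.
Proof. by move=> JP; exists J. Qed.

Lemma l2norm_cvg xi :
  partial_sum (fun i => ((cnorm (xi i) ^+ 2)%:C)%C : C) @ totally
    --> (((l2norm xi ^+ 2)%:C)%C : C).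
Proof.
apply: cvg_cnorm => e /(fsum_approx xi)[J Je].
apply: (near_totally (J := J)) => K JK /=.
rewrite partial_sumE -rmorph_sum -rmorphB/= cnormC.
rewrite ger0_norm ?subr_ge0 ?fsum_le_l2norm//.
have := fsum_sub (fun i => sqr_ge0 (cnorm (xi i))) JK; lra.
Qed.

(** The right-hand side of the polarization identity. It turns the convergence
    of a sum of complex terms into that of sums of nonnegative reals, which is
    [l2norm_cvg]. *)
Definition polar xi eta : C := 4^-1 * (((l2norm (xi + eta) ^+ 2)%:C)%C
  - ((l2norm (xi - eta) ^+ 2)%:C)%C
  + 'i * ((l2norm (xi + 'i *: eta) ^+ 2)%:C)%C
  - 'i * ((l2norm (xi - 'i *: eta) ^+ 2)%:C)%C).

Lemma polarE (z w : C) : z * w^* = 4^-1 * (((cnorm (z + w) ^+ 2)%:C)%C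
  - ((cnorm (z - w) ^+ 2)%:C)%C
  + 'i * ((cnorm (z + 'i * w) ^+ 2)%:C)%C
  - 'i * ((cnorm (z - 'i * w) ^+ 2)%:C)%C).
Proof.
rewrite !cnorm_sqr !rmorphD !rmorphN !rmorphM/= conjCi.
have i2 : 'i * 'i = -1 :> C by rewrite -expr2 sqrCi.
by field: i2.
Qed.

Lemma inner_cvg_polar xi eta :
  partial_sum (fun i => xi i * (eta i)^* : C) @ totally --> polar xi eta.
Proof.
pose S zeta := partial_sum (fun i => ((cnorm (zeta i) ^+ 2)%:C)%C : C).
have -> : partial_sum (fun i => xi i * (eta i)^* : C) = (fun J => 4^-1 *
   (S (xi + eta) J - S (xi - eta) J
    + 'i * S (xi + 'i *: eta) J - 'i * S (xi - 'i *: eta) J)).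
  apply/funext => J; rewrite /S !partial_sumE !mulr_sumr -!sumrN -!big_split/=.
  by rewrite mulr_sumr; apply: eq_bigr => i _; rewrite polarE.
apply: cvgM; first exact: cvg_cst.
have icvg zeta : (fun J => 'i * S zeta J) @ totally -->
    ('i * ((l2norm zeta ^+ 2)%:C)%C : C).
  by apply: cvgM; [exact: cvg_cst|exact: l2norm_cvg].
have := cvgB (cvgD (cvgB (l2norm_cvg (xi := xi + eta))
  (l2norm_cvg (xi := xi - eta))) (icvg (xi + 'i *: eta)))
  (icvg (xi - 'i *: eta)).
exact.
Qed.

Lemma inner_lim xi eta l :
  partial_sum (fun i => xi i * (eta i)^* : C) @ totally --> l ->
  inner xi eta = l.
Proof.
by move=> cv; rewrite /inner /summability.sum (cvg_lim _ cv).
Qed.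

Lemma inner_polar xi eta : inner xi eta = polar xi eta.
Proof. exact/inner_lim/inner_cvg_polar. Qed.

Lemma inner_cvg xi eta :
  partial_sum (fun i => xi i * (eta i)^* : C) @ totally --> inner xi eta.
Proof. by rewrite inner_polar; exact: inner_cvg_polar. Qed.

Lemma inner_disjoint xi eta :
  (forall i, xi i * (eta i)^* = 0) -> inner xi eta = 0.
Proof.
move=> z; apply: inner_lim; rewrite (_ : partial_sum _ = fun=> 0).
  exact: cvg_cst.
by apply/funext => J; rewrite partial_sumE big1.
Qed.

Lemma inner_norm xi : inner xi xi = ((l2norm xi ^+ 2)%:C)%C.
Proof.
apply: inner_lim; rewrite (_ : (fun i => _) = fun i =>
  ((cnorm (xi i) ^+ 2)%:C)%C : C); first exact: l2norm_cvg.
by apply/funext => i; rewrite -cnorm_sqr.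
Qed.

Lemma inner_linearl a xi zeta eta :
  inner (a *: xi + zeta) eta = a * inner xi eta + inner zeta eta.
Proof.
apply: inner_lim; pose S xi := partial_sum (fun i => xi i * (eta i)^* : C).
rewrite (_ : partial_sum _ = (fun J => a * S xi J + S zeta J)); last first.
  apply/funext => J; rewrite /S !partial_sumE mulr_sumr -big_split/=.
  by apply: eq_bigr => i _; rewrite mulrDl mulrA.
by apply: cvgD; [apply: cvgM; first exact: cvg_cst|]; exact: inner_cvg.
Qed.

Lemma inner_conj xi eta : inner eta xi = (inner xi eta)^*.
Proof.
apply: inner_lim; apply: cvg_cnorm => e e0.
have near_inner :=
  cnorm_cvg_lt (FF := _) (inner_cvg (xi := xi) (eta := eta)) e0.
case: near_inner => J0 _ J0e; apply: (near_totally (J := J0)) => J /J0e /=.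
rewrite -cnorm_conj rmorphB/= !partial_sumE rmorph_sum/=.
by under eq_bigr do rewrite rmorphM/= conjCK mulrC.
Qed.

(** The weight c spares a separate treatment of scaling: choosing it as
    ||eta|| / ||xi|| gives the Cauchy-Schwarz inequality. *)
Lemma inner_le_weighted xi eta (c : R) : 0 < c ->
  2 * cnorm (inner xi eta) <= c * l2norm xi ^+ 2 + c^-1 * l2norm eta ^+ 2.
Proof.
move=> c0; rewrite -lerBlDr; apply/ler_addgt0Pr => e e0.
have e20 : 0 < e / 2 by rewrite divr_gt0.
pose S J := \sum_(i <- J) xi i * (eta i)^*.
(* It suffices to bound a partial sum close to the inner product; there the
   inequality holds term by term. *)
have [J Je] : exists J : {fset I}, cnorm (inner xi eta - S J) < e / 2.
  have near_inner :=
    cnorm_cvg_lt (FF := _) (inner_cvg (xi := xi) (eta := eta)) e20.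
  case: near_inner => J _ Je; exists J; rewrite /S -partial_sumE.
  by apply: Je => /=.
have leJ : 2 * cnorm (S J) <= c * l2norm xi ^+ 2 + c^-1 * l2norm eta ^+ 2.
  apply: (@le_trans _ _ (c * (\sum_(i <- J) cnorm (xi i) ^+ 2)
      + c^-1 * (\sum_(i <- J) cnorm (eta i) ^+ 2))).
    rewrite !mulr_sumr -big_split/=.
    apply: (@le_trans _ _ (\sum_(i <- J) 2 * (cnorm (xi i) * cnorm (eta i)))).
      rewrite -mulr_sumr ler_pM2l// /S.
      elim/big_ind2 : _ => [|z x w y zx wy|i _]; first by rewrite cnorm0.
        by rewrite (le_trans (cnormD _ _))// lerD.
      by rewrite cnormM cnorm_conj.
    apply: ler_sum => i _; set x := cnorm _; set y := cnorm _.
    rewrite -subr_ge0 (_ : _ - _ = c * (x - c^-1 * y) ^+ 2); last first.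
      by field; rewrite gt_eqF.
    by rewrite mulr_ge0 ?sqr_ge0// ltW.
  by rewrite lerD// ler_pM2l ?invr_gt0// fsum_le_l2norm.
have := cnormD (inner xi eta - S J) (S J).
rewrite subrK; lra.
Qed.

Lemma l2norm_eq0 xi : l2norm xi = 0 -> xi = 0.
Proof.
move=> xi0; apply: l2P => i; apply: cnorm_eq0; apply/eqP.
by rewrite eq_le cnorm_ge0 -xi0 cnorm_le_l2norm.
Qed.

Lemma inner0l eta : inner (0 : H) eta = 0.
Proof.
by have := inner_linearl (-1) 0 0 eta; rewrite scaler0 addr0 mulN1r addNr.
Qed.

Lemma inner0r eta : inner eta (0 : H) = 0.
Proof. by rewrite inner_conj inner0l conjC0. Qed.

Lemma cnorm_inner_le xi eta : cnorm (inner xi eta) <= l2norm xi * l2norm eta.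
Proof.
have [->|xi0] := eqVneq xi 0; first by rewrite inner0l cnorm0 l2norm0 mul0r.
have [->|eta0] := eqVneq eta 0; first by rewrite inner0r cnorm0 l2norm0 mulr0.
have pos zeta : zeta != 0 -> 0 < l2norm zeta.
  by rewrite lt0r l2norm_ge0 andbT; apply: contra_neq; exact: l2norm_eq0.
have x0 := pos _ xi0; have y0 := pos _ eta0.
have := @inner_le_weighted xi eta (l2norm eta / l2norm xi) (divr_gt0 y0 x0).
rewrite (_ : _ + _ = 2 * (l2norm xi * l2norm eta)); first by rewrite ler_pM2l.
by field; rewrite !gt_eqF.
Qed.

End l2_inner.

(** * Adjoints and norms of bounded operators *)

Section adjoints.
Variables (R : realType) (I : choiceType).
Local Notation C := (Cx R).
Local Notation H := (l2 R I).
Implicit Types (xi eta zeta : H) (J K : {fset I}) (S T : bop R I).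

Lemma bopD T xi eta : T (xi + eta) = T xi + T eta.
Proof. by have := bop_linear T 1 xi eta; rewrite !scale1r. Qed.

Lemma bop0 T : T 0 = 0.
Proof. by apply: (addIr (T 0)); rewrite -bopD !add0r. Qed.

Lemma bopZ T a xi : T (a *: xi) = a *: T xi.
Proof. by have := bop_linear T a xi 0; rewrite !addr0 bop0 addr0. Qed.

Lemma bopB T xi eta : T (xi - eta) = T xi - T eta.
Proof. by rewrite bopD -scaleN1r bopZ scaleN1r. Qed.

Lemma bop_sum T (J : seq I) (v : I -> H) :
  T (\sum_(i <- J) v i) = \sum_(i <- J) T (v i).
Proof. exact: (big_morph T (bopD T) (bop0 T)). Qed.

Lemma bop_sumE (K : Type) (r : seq K) (P : pred K) (F : K -> bop R I) xi :
  (\sum_(k <- r | P k) F k) xi = \sum_(k <- r | P k) F k xi.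
Proof. exact: (big_morph (fun T : bop R I => T xi)). Qed.

Lemma l2_sumE (K : Type) (r : seq K) (P : pred K) (v : K -> H) i :
  (\sum_(k <- r | P k) v k) i = \sum_(k <- r | P k) v k i.
Proof. exact: (big_morph (fun xi : H => xi i)). Qed.

Lemma l2B xi eta i : (xi - eta) i = xi i - eta i.
Proof. by []. Qed.

Lemma fsum_delta p J : \sum_(i <- J) cnorm ((i == p)%:R : C) ^+ 2 <= 1.
Proof.
apply: le_trans; first apply: (fsum_le_supp (J := [fset p]%fset)) => [i|i].
- by rewrite sqr_ge0.
- by rewrite inE => /negPf ->; rewrite cnorm0 expr0n.
- by rewrite big_seq_fset1 eqxx /cnorm normr1 expr1n.
Qed.

Lemma sqsummable_delta p : (fun i => (i == p)%:R : C) \in @sqsummable R I.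
Proof.
apply/asboolP; apply: (@le_lt_trans _ _ 1%:E); last exact: ltry.
by apply/sqsum_leP => J; rewrite lee_fin fsum_delta.
Qed.

Definition delta p : H := L2 (sqsummable_delta p).

Lemma deltaE p i : delta p i = (i == p)%:R.
Proof. by []. Qed.

Lemma inner_delta p eta : inner (delta p) eta = (eta p)^*.
Proof.
apply: inner_lim; apply: cvg_cnorm => e e0.
apply: (near_totally (J := [fset p]%fset)) => J; rewrite fsub1set => pJ /=.
rewrite partial_sumE (big_fsetD1 p)//= eqxx mul1r big_seq big1 => [|i].
  by rewrite addr0 subrr cnorm0.
by rewrite in_fsetD1 => /andP[/negPf -> _]; rewrite mul0r.
Qed.

Lemma l2norm_delta p : l2norm (delta p) <= 1.
Proof.
rewrite -(@ler_pXn2r _ 2) ?nnegrE ?l2norm_ge0// expr1n.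
by apply: l2norm_sqr_le => J; exact: fsum_delta.
Qed.

Lemma delta_combE (c : I -> C) J i :
  (\sum_(j <- J) c j *: delta j) i = if i \in J then c i else 0.
Proof.
rewrite l2_sumE; case: ifPn => iJ.
  rewrite (big_fsetD1 i)// l2Z deltaE eqxx mulr1 big1_seq; first exact: addr0.
  move=> j /andP[_]; rewrite in_fsetD1 eq_sym => /andP[/negPf ij _].
  by rewrite l2Z deltaE ij mulr0.
rewrite big_seq big1// => j jJ; rewrite l2Z deltaE.
by rewrite (_ : (i == j) = false) ?mulr0//; apply: contraNF iJ => /eqP ->.
Qed.

Definition trunc J xi : H := \sum_(i <- J) xi i *: delta i.

Lemma truncE J xi i : trunc J xi i = if i \in J then xi i else 0.
Proof. exact: delta_combE. Qed.

(** Finitely supported vectors are dense: outside J the remainder has exactly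
    the mass of xi that the partial sum over J leaves out. *)
Lemma trunc_approx xi J0 (e : R) : 0 < e ->
  exists2 J, (J0 `<=` J)%fset & l2norm (xi - trunc J xi) <= e.
Proof.
move=> e0; have [J1 J1e] := fsum_approx xi (exprn_gt0 2 e0).
exists (J0 `|` J1)%fset; first exact: fsubsetUl.
have := fsum_sub (fun i => sqr_ge0 (cnorm (xi i))) (fsubsetUr J0 J1).
move: (J0 `|` J1)%fset => J /(lt_le_trans J1e) {J1e}Je.
rewrite -(@ler_pXn2r _ 2) ?nnegrE ?l2norm_ge0 ?(ltW e0)//.
apply: l2norm_sqr_le => K.
have splitJK (f : I -> R) : \sum_(i <- (J `|` K)%fset) f i =
    \sum_(i <- J) f i + \sum_(i <- (J `|` K)%fset | i \notin J) f i.
  rewrite (bigID (mem J))/=; congr (_ + _).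
  rewrite -[LHS]big_filter; apply: perm_big; apply: uniq_perm.
  - by rewrite filter_uniq ?fset_uniq.
  - exact: fset_uniq.
  - by move=> i; rewrite mem_filter in_fsetU; case: (i \in J).
have := fsum_le_l2norm xi (J `|` K)%fset.
have := fsum_sub (fun i => sqr_ge0 (cnorm ((xi - trunc J xi) i)))
  (fsubsetUr J K).
have z0 : \sum_(i <- J) cnorm ((xi - trunc J xi) i) ^+ 2 = 0.
  rewrite big_seq big1 // => i iJ.
  by rewrite l2B truncE iJ subrr cnorm0 expr0n.
rewrite !splitJK z0 add0r [X in _ <= X -> _](eq_bigr
  (fun i => cnorm (xi i) ^+ 2)) => [|i iJ]; last first.
  by rewrite l2B truncE (negPf iJ) subr0.
by move: Je; lra.
Qed.

Lemma inner_suml (K : Type) (r : seq K) (v : K -> H) eta :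
  inner (\sum_(k <- r) v k) eta = \sum_(k <- r) inner (v k) eta.
Proof.
apply: (big_morph (fun xi => inner xi eta)) => [x y|]; last exact: inner0l.
by have := inner_linearl 1 x y eta; rewrite scale1r mul1r.
Qed.

Lemma innerZl a xi eta : inner (a *: xi) eta = a * inner xi eta.
Proof. by have := inner_linearl a xi 0 eta; rewrite inner0l !addr0. Qed.

Lemma innerBl xi zeta eta :
  inner (xi - zeta) eta = inner xi eta - inner zeta eta.
Proof.
by rewrite addrC -scaleN1r inner_linearl mulN1r addrC.
Qed.

Lemma inner_linearr a xi zeta eta :
  inner eta (a *: xi + zeta) = a^* * inner eta xi + inner eta zeta.
Proof.
by rewrite inner_conj inner_linearl rmorphD rmorphM/= -!inner_conj.
Qed.

Lemma innerZr a xi eta : inner eta (a *: xi) = a^* * inner eta xi.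
Proof. by have := inner_linearr a xi 0 eta; rewrite inner0r !addr0. Qed.

Lemma innerBr xi zeta eta :
  inner eta (xi - zeta) = inner eta xi - inner eta zeta.
Proof.
by rewrite addrC -scaleN1r inner_linearr rmorphN1 mulN1r addrC.
Qed.

Lemma inner_eq xi zeta :
  (forall eta, inner eta xi = inner eta zeta) -> xi = zeta.
Proof.
move=> e; apply: l2P => i; have := e (delta i); rewrite !inner_delta.
by move=> /(congr1 (@Num.conj _)); rewrite !conjCK.
Qed.

(** The coordinates of the future adjoint of T at eta are square-summable: for
    finite J, their squared mass N over J is the inner product of T v and eta
    where v is the truncated family itself, so N <= ||T|| ||eta|| N^(1/2). *)
Lemma adj_summable T eta :
  (fun p => (inner (T (delta p)) eta)^*) \in @sqsummable R I.
Proof.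
have [M M0 TM] := bop_pos_bound T.
apply/asboolP; apply: (@le_lt_trans _ _ ((M * l2norm eta) ^+ 2)%:E);
  last exact: ltry.
apply/sqsum_leP => J; rewrite lee_fin.
pose c i := (inner (T (delta i)) eta)^*.
pose v : H := \sum_(i <- J) c i *: delta i.
set N := (X in X <= _).
have N0 : 0 <= N by apply: sumr_ge0 => i _; rewrite sqr_ge0.
have vN : l2norm v ^+ 2 <= N.
  apply: l2norm_sqr_le => K.
  apply: le_trans; first apply: (fsum_le_supp (J := J)) => [i|i /negPf iJ].
  - by rewrite sqr_ge0.
  - by rewrite delta_combE iJ cnorm0 expr0n.
  rewrite big_seq [leRHS]big_seq ler_sum// => i iJ.
  by rewrite delta_combE iJ.
have NE : ((N%:C)%C : C) = inner (T v) eta.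
  rewrite bop_sum inner_suml rmorph_sum/=; apply: eq_bigr => i _.
  by rewrite bopZ innerZl cnorm_sqr /c conjCK.
have := cnorm_inner_le (T v) eta; rewrite -NE cnormC ger0_norm// => NTv.
have {}NTv : N <= (M * l2norm eta) * l2norm v.
  by rewrite (le_trans NTv)// mulrAC ler_wpM2r ?l2norm_ge0.
(* N <= A ||v|| and ||v||^2 <= N give N <= A^2, as (A - ||v||)^2 >= 0. *)
have := sqr_ge0 (M * l2norm eta - l2norm v).
rewrite sqrrB; lra.
Qed.

Definition adjfun T eta : H := L2 (adj_summable T eta).

Fact adjfun_linear T : linear (adjfun T).
Proof.
move=> a x y; apply: l2P => p; rewrite l2D l2Z /= inner_linearr.
by rewrite rmorphD rmorphM/= conjCK.
Qed.

(** Holds by definition when xi is a basis vector, hence when xi is finitely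
    supported, and in general by density. *)
Lemma adjfunP T xi eta : inner (T xi) eta = inner xi (adjfun T eta).
Proof.
have [M M0 TM] := bop_pos_bound T.
have deltaP p : inner (T (delta p)) eta = inner (delta p) (adjfun T eta).
  by rewrite inner_delta /= conjCK.
have truncP J : inner (T (trunc J xi)) eta = inner (trunc J xi) (adjfun T eta).
  rewrite bop_sum !inner_suml; apply: eq_bigr => i _.
  by rewrite bopZ !innerZl deltaP.
apply/subr0_eq; apply: cnorm_eq0; apply/eqP; rewrite eq_le cnorm_ge0 andbT.
apply/ler_addgt0Pr => e e0; rewrite add0r.
set K := M * l2norm eta + l2norm (adjfun T eta) + 1.
have K0 : 0 < K by rewrite ltr_wpDl ?addr_ge0 ?mulr_ge0 ?l2norm_ge0.
have [J _ Je] := trunc_approx xi fset0 (divr_gt0 e0 K0).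
set z := xi - trunc J xi in Je.
rewrite (_ : _ - _ = inner (T z) eta - inner z (adjfun T eta)); last first.
  by rewrite bopB !innerBl truncP; ring.
apply: (@le_trans _ _ (l2norm z * K)); last by rewrite -ler_pdivlMr.
rewrite (le_trans (cnormD _ _))// {2}/cnorm normrN -/(cnorm _).
apply: (@le_trans _ _ (M * l2norm z * l2norm eta +
    l2norm z * l2norm (adjfun T eta))).
  rewrite lerD ?cnorm_inner_le//.
  by rewrite (le_trans (cnorm_inner_le _ _))// ler_wpM2r ?l2norm_ge0.
by have := l2norm_ge0 z; rewrite /K; lra.
Qed.

Fact adjfun_bounded T :
  exists M : R, forall xi, l2norm (adjfun T xi) <= M * l2norm xi.
Proof.
have [M M0 TM] := bop_pos_bound T; exists M => eta.
have := cnorm_inner_le (T (adjfun T eta)) eta.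
rewrite adjfunP inner_norm cnormC ger0_norm ?sqr_ge0// => le_n.
have [-> |n0] := eqVneq (l2norm (adjfun T eta)) 0.
  by rewrite mulr_ge0 ?l2norm_ge0.
rewrite -(@ler_pM2l _ (l2norm (adjfun T eta))) ?lt0r ?n0 ?l2norm_ge0//.
rewrite -expr2 (le_trans le_n)// mulrA [_ * M]mulrC.
by rewrite ler_wpM2r ?l2norm_ge0.
Qed.

(** Since an adjoint exists, the choice made by [adj] satisfies its
    specification, and it is unique by [adj_unique]. *)
Lemma adjP T xi eta : inner (T xi) eta = inner xi (adj T eta).
Proof.
rewrite /adj; case: xgetP => [S _ ->//|].
move=> /(_ (Bop (adjfun_linear T) (adjfun_bounded T))).
by case=> ? ?; exact: adjfunP.
Qed.

Lemma adj_unique T S : (forall xi eta, inner (T xi) eta = inner xi (S eta)) ->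
  adj T = S.
Proof.
by move=> TS; apply: bopP => eta; apply: inner_eq => xi; rewrite -adjP TS.
Qed.

Lemma adj_coef T eta p : adj T eta p = (inner (T (delta p)) eta)^*.
Proof. by rewrite adjP inner_delta conjCK. Qed.

Lemma adjM S T : adj (S * T) = adj T * adj S.
Proof. by apply: adj_unique => xi eta /=; rewrite !adjP. Qed.

Lemma innerDr xi eta zeta :
  inner xi (eta + zeta) = inner xi eta + inner xi zeta.
Proof.
by have := inner_linearr 1 eta zeta xi; rewrite scale1r conjC1 mul1r.
Qed.

Lemma innerDl xi eta zeta :
  inner (eta + zeta) xi = inner eta xi + inner zeta xi.
Proof. by have := inner_linearl 1 eta zeta xi; rewrite scale1r mul1r. Qed.

Lemma adj0 : adj (0 : bop R I) = 0.
Proof. by apply: adj_unique => xi eta /=; rewrite inner0l inner0r. Qed.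

Lemma adjD S T : adj (S + T) = adj S + adj T.
Proof.
by apply: adj_unique => xi eta /=; rewrite innerDl innerDr !adjP.
Qed.

Lemma adj_sum (K : Type) (r : seq K) (P : pred K) (F : K -> bop R I) :
  adj (\sum_(k <- r | P k) F k) = \sum_(k <- r | P k) adj (F k).
Proof. exact: (big_morph (@adj R I) adjD adj0). Qed.

Lemma opnorm_has_sup T :
  has_sup [set l2norm (T xi) | xi in [set xi | l2norm xi <= 1]].
Proof.
have [M M0 TM] := bop_pos_bound T; split.
  by exists (l2norm (T 0)); exists 0 => //=; rewrite l2norm0.
exists M => _ [xi /= xi1 <-]; rewrite (le_trans (TM _))//.
by rewrite ler_piMr.
Qed.

Lemma le_opnorm T xi : l2norm xi <= 1 -> l2norm (T xi) <= opnorm T.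
Proof.
move=> xi1; apply: ub_le_sup; first by case: (opnorm_has_sup T).
by exists xi.
Qed.

Lemma opnorm_le T (c : R) :
  (forall xi, l2norm xi <= 1 -> l2norm (T xi) <= c) -> opnorm T <= c.
Proof.
move=> Tc; apply: ge_sup; first by case: (opnorm_has_sup T).
by move=> _ [xi xi1 <-]; exact: Tc.
Qed.

Lemma coef_le_opnorm T p q : cnorm (T (delta p) q) <= opnorm T.
Proof.
by rewrite (le_trans (cnorm_le_l2norm _ _))// le_opnorm// l2norm_delta.
Qed.

End adjoints.

(** * Matrix coefficients of elements of the crossed product *)

Section crossed_product_coefficients.
Variables (R : realType) (G : groupType) (X : topologicalType).
Variables (Xcompact : compact [set: X]) (al : taction G X).
Local Notation C := (Cx R).
Local Notation H := (l2 R (G * X)%type).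
Local Notation B := (bop R (G * X)%type).
Local Notation mulop := (mulop Xcompact al).
Local Notation transop := (@transop R G X).
Local Notation algebraic := (@algebraic_crossed_product R G X Xcompact al).
Local Notation crossed := (@crossed_product R G X Xcompact al).
Implicit Types (xi eta : H) (S T : B).

Lemma mulopE f xi p : mulop f xi p = f (al p.1 p.2) * xi p.
Proof. by []. Qed.

Lemma transopE g xi p : transop g xi p = xi (g^-1 * p.1, p.2)%g.
Proof. by []. Qed.

Lemma l2norm_mulop_le (f : cfun R X) (c : R) xi : 0 <= c ->
  (forall x, cnorm (f x) <= c) -> l2norm (mulop f xi) <= c * l2norm xi.
Proof.
move=> c0 fc; apply: l2norm_le => //.
apply: sqsum_le => [|i]; rewrite ?sqr_ge0//=.
rewrite cnormM exprMn ler_wpM2r ?sqr_ge0//.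
by rewrite ler_pXn2r ?nnegrE ?cnorm_ge0.
Qed.

Lemma adj_mulop (f : cfun R X) : (forall x, (f x)^* = f x) ->
  adj (mulop f) = mulop f.
Proof.
move=> fR; apply: adj_unique => xi eta; rewrite /inner; congr summability.sum.
by apply/funext => p; rewrite !mulopE rmorphM/= fR mulrCA mulrA.
Qed.

(** Translations are isometric, hence by polarization unitary. *)
Lemma inner_transop g xi eta :
  inner (transop g xi) (transop g eta) = inner xi eta.
Proof.
rewrite !inner_polar /polar -!bopZ -!bopB -!bopD.
have n zeta : l2norm (transop g zeta) = l2norm zeta.
  by rewrite /l2norm sqsum_trans.
by rewrite !n.
Qed.

Lemma adj_transop g : adj (transop g) = transop g^-1%g.
Proof.
apply: adj_unique => xi eta.
rewrite -(inner_transop g xi (transop g^-1 eta)); congr inner.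
by apply: l2P => -[s x]; rewrite !transopE /= invgK mulVKg.
Qed.

Lemma algebraic_coef (l : seq (cfun R X * G)) r x s y :
  (\sum_(p <- l) mulop p.1 * transop p.2 : B) (delta R (r, x)) (s, y) =
  \sum_(p <- l) p.1 (al s y) * ((p.2^-1 * s == r)%g && (y == x))%:R.
Proof.
rewrite bop_sumE l2_sumE; apply: eq_bigr => p _.
by rewrite mulopE transopE deltaE.
Qed.

Lemma algebraic_coef_diag (l : seq (cfun R X * G)) r x s :
  (\sum_(p <- l) mulop p.1 * transop p.2 : B) (delta R (r, x)) (s, x) =
  \sum_(p <- l) p.1 (al s x) * ((p.2^-1 * s == r)%g)%:R.
Proof.
by rewrite algebraic_coef; apply: eq_bigr => p _; rewrite eqxx andbT.
Qed.

(** Each matrix coefficient is bounded by the operator norm, so identities and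
    continuity of coefficients pass from the algebraic crossed product to its
    closure. This is the tool of the next three lemmas. *)
Lemma crossed_coef_approx T (e : R) : crossed T -> 0 < e ->
  exists2 S, algebraic S &
    forall p q, cnorm (T (delta R p) q - S (delta R p) q) < e.
Proof.
move=> /[apply] -[S algS TS]; exists S => // p q.
exact: le_lt_trans (coef_le_opnorm (T - S) p q) TS.
Qed.

Lemma coef_support T r x s y : crossed T -> y <> x ->
  T (delta R (r, x)) (s, y) = 0.
Proof.
move=> cT /eqP yx; apply: cnorm_arb_small => e.
move=> /(crossed_coef_approx cT)[S [l ->] TS].
have := TS (r, x) (s, y); rewrite algebraic_coef big1 ?subr0 => [/ltW//|p _].
by rewrite (negPf yx) andbF mulr0.
Qed.

(** Both sides are the Fourier coefficient of T at s r^-1, evaluated at the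
    point s x: the base point of an orbit may be changed freely. *)
Lemma coef_translate T r x s : crossed T ->
  T (delta R (r, x)) (s, x) =
  T (delta R (1%g, al r x)) ((s * r^-1)%g, al r x).
Proof.
move=> cT; apply/subr0_eq/cnorm_arb_small => e e0.
have e20 : 0 < e / 2 by rewrite divr_gt0.
have [S [l ->] TS] := crossed_coef_approx cT e20.
have := TS (r, x) (s, x).
have := TS (1%g, al r x) ((s * r^-1)%g, al r x).
rewrite !algebraic_coef_diag -tactionM mulgVK.
set S1 := \sum_(p <- l) _; set S2 := \sum_(p <- l) _.
have -> : S2 = S1.
  apply: eq_bigr => p _; congr (_ * _); congr ((nat_of_bool _)%:R).
  by rewrite -[RHS](inj_eq (@mulIg _ r)) mul1g -mulgA mulgVK.
set t1 := T _ _; set t2 := T _ _; rewrite cnormB => h1 h2.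
rewrite (_ : t2 - t1 = (t2 - S1) + (S1 - t1)); last by ring.
by rewrite (le_trans (cnormD _ _))//; lra.
Qed.

(** A uniform limit of the continuous coefficients of algebraic elements. *)
Lemma coef_continuous T g : crossed T ->
  continuous (fun z => T (delta R (1%g, z)) (g, z) : C).
Proof.
move=> cT z; apply: cvg_cnorm => e e0.
have e40 : 0 < e / 4 by rewrite divr_gt0.
have [S [l defS] TS] := crossed_coef_approx cT e40.
have cS : continuous (fun z => S (delta R (1%g, z)) (g, z) : C).
  rewrite {}defS {TS}.
  rewrite (_ : (fun _ => _) = fun z =>
    \sum_(p <- l) p.1 (al g z) * ((p.2^-1 * g == 1)%g)%:R); last first.
    by apply/funext => w; rewrite algebraic_coef_diag.
  elim: l => [|p l IHl] w.
    rewrite (_ : (fun _ => _) = fun=> 0); first exact: cvg_cst.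
    by apply/funext => v; rewrite big_nil.
  rewrite (_ : (fun _ => _) = (fun v => p.1 (al g v) * ((p.2^-1 * g == 1)%g)%:R
    + \sum_(p <- l) p.1 (al g v) * ((p.2^-1 * g == 1)%g)%:R)); last first.
    by apply/funext => v; rewrite big_cons.
  apply: cvgD; last exact: IHl.
  apply: cvgM; last exact: cvg_cst.
  apply: (@continuous_comp _ _ _ (al g) p.1); first exact: taction_continuous.
  exact: cts_fun.
have near_z := cnorm_cvg_lt (FF := nbhs_filter z) (cS z) e40.
apply: (@filterS _ _ (nbhs_filter z) _ _ _ near_z) => w /= Sw.
have := TS (1%g, z) (g, z); have := TS (1%g, w) (g, w).
set t1 := T (delta R (1%g, w)) _; set t2 := T (delta R (1%g, z)) _.
move: Sw; set s1 := S (delta R (1%g, w)) _; set s2 := S (delta R (1%g, z)) _.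
move=> Sw h1 h2.
rewrite cnormB in h1.
rewrite (_ : t2 - t1 = (t2 - s2) + ((s2 - s1) + (s1 - t1))); last by ring.
rewrite (le_lt_trans (cnormD _ _))//.
have := cnormD (s2 - s1) (s1 - t1).
lra.
Qed.

End crossed_product_coefficients.

(** * Continuous functions on compact Hausdorff spaces *)

Section compact_hausdorff.
Variables (R : realType) (X : topologicalType).

Definition real_cfun (f : X -> R) (cf : continuous f) : cfun R X :=
  mkcts (fun x => continuous_comp (cf x) (@complex_of_real_continuous R (f x))).

Lemma real_cfunE f (cf : continuous f) x : real_cfun cf x = ((f x)%:C)%C.
Proof. by []. Qed.

Lemma conj_real_cfun f (cf : continuous f) x :
  (real_cfun cf x)^* = real_cfun cf x.
Proof. by rewrite real_cfunE; exact: conjc_real. Qed.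

Lemma Re_cfun_continuous (f : cfun R X) :
  continuous (fun x => complex.Re (f x)).
Proof.
move=> x; apply: (@continuous_comp _ _ _ f (@complex.Re R)).
  exact: cts_fun.
exact: Re_continuous.
Qed.

Lemma max_continuous (f g : X -> R) : continuous f -> continuous g ->
  continuous (fun x => Num.max (f x) (g x)).
Proof.
by move=> cf cg x; apply: (@continuous_max _ _ f g); [exact: cf|exact: cg].
Qed.

Lemma subr_cst_continuous (f : X -> R) (c : R) : continuous f ->
  continuous (fun x => f x - c).
Proof. by move=> cf x; apply: cvgB; [exact: cf|exact: cvg_cst]. Qed.

Lemma compact_fset_cover (A : set X) (I : choiceType) (f : I -> set X) :
  compact A -> (forall i, open (f i)) -> A `<=` \bigcup_i f i ->
  exists D : {fset I}, A `<=` \bigcup_(i in [set` D]) f i.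
Proof.
move=> cA of_ Af.
have [->|/set0P[x _]] := eqVneq A set0; first by exists fset0.
(* Cover compactness is a property of pointed spaces; x serves as base point. *)
pose Xp : ptopologicalType := HB.pack X (isPointed.Build X x).
have cover : @cover_compact Xp A by rewrite -compact_cover.
have [//|D _ AD] := cover I setT f (fun i _ => of_ i).
by exists D.
Qed.

Lemma compact_lower_bound (A : set X) (f : X -> R) : compact A ->
  continuous f -> (forall x, A x -> 0 < f x) ->
  exists2 e, 0 < e & forall x, A x -> e <= f x.
Proof.
move=> cA cf fA.
have [->|A0] := eqVneq A set0; first by exists 1.
have cfA : {within A, continuous f} by exact: continuous_subspaceT.
have /set0P A0' := A0.
have [c /set_mem Ac minc] := compact_EVT_min A0' cA cfA.
by exists (f c) => [|x Ax]; [exact: fA|apply: minc; exact: mem_set].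
Qed.

Hypotheses (Xcompact : compact [set: X]) (Xhausdorff : hausdorff_space X).

Lemma urysohn_fun (A B : set X) : closed A -> closed B -> A `&` B = set0 ->
  exists f : X -> R, [/\ continuous f, forall x, 0 <= f x <= 1,
    forall x, A x -> f x = 0 & forall x, B x -> f x = 1].
Proof.
move=> clA clB AB0.
have /(normal_separatorP (R := R)) := compact_normal Xhausdorff Xcompact.
move=> /(_ A B clA clB AB0) /(@uniform_separatorP _ R)[f [cf f01 fA fB]].
exists f; split => // x.
- by have /= := f01 (f x) (ex_intro2 _ _ x I erefl); rewrite in_itv.
- by move=> Ax; apply: fA; exists x.
- by move=> Bx; apply: fB; exists x.
Qed.

Lemma bump_fun (s : seq X) y : y \notin s ->
  exists f : X -> R, [/\ continuous f, forall x, 0 <= f x <= 1,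
    forall x, x \in s -> f x = 0 & f y = 1].
Proof.
move=> ys.
have cl (A : set X) : finite_set A -> closed A.
  by move=> finA; apply: compact_closed => //; exact: finite_compact.
have [|||f [cf f01 f0 f1]] := @urysohn_fun [set` s] [set y].
- by apply: cl; exact: finite_seq.
- exact: cl.
- by rewrite -subset0 => z [/= zs zy]; move: ys; rewrite -zy zs.
by exists f; split => //; exact: f1.
Qed.

(** Induction on the number of open sets: the part of F outside the first J sets
    is a closed subset of U J, on which a Urysohn function g vanishing off U J
    is 1; a point of F where g <= 1/2 lies in one of the first J sets. *)
Lemma subordinate_functions (J : nat) (F : set X) (U : nat -> set X) :
  closed F ->
  (forall j, (j < J)%N -> open (U j)) ->
  F `<=` \bigcup_(j in [set j | (j < J)%N]) U j ->
  exists f : nat -> X -> R, [/\ forall j, continuous (f j),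
    forall j, (j < J)%N -> forall x, ~ U j x -> f j x = 0,
    forall j x, 0 <= f j x &
    forall x, F x -> exists2 j, (j < J)%N & 1 / 2 <= f j x].
Proof.
elim: J F => [|J IHJ] F clF oU FU.
  exists (fun _ _ => 0); split => // [j x|x /FU[]//]; exact: cvg_cst.
pose V := \bigcup_(j in [set j | (j < J)%N]) U j.
have oV : open V by apply: bigcup_open => j /= jJ; apply: oU; exact: ltnW.
have oUJ : open (U J) by exact: oU.
have [|||g [cg g01 g0 g1]] := @urysohn_fun (~` U J) (F `&` ~` V).
- exact: open_closedC.
- by apply: closedI => //; exact: open_closedC.
- rewrite -subset0 => x [/= nU [Fx nV]]; have [j /=] := FU _ Fx.
  rewrite ltnS leq_eqVlt => /orP[/eqP -> //|jJ Ux]; apply: nV.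
  by exists j.
pose F' := F `&` [set x | g x <= 1 / 2].
have clF' : closed F'.
  apply: closedI => //.
  apply: (@closed_comp _ _ g [set r | r <= 1 / 2]) => [x _|].
    exact: cg.
  exact: closed_le.
have [j jJ||f [cf f0 fge fF]] := IHJ F' clF'.
- by apply: oU; exact: ltnW.
- move=> x [Fx /= gx]; apply: contrapT => nVx.
  by have := g1 x (conj Fx nVx); lra.
exists (fun j => if j == J then g else f j); split.
- by move=> j; case: eqP.
- move=> j; rewrite ltnS leq_eqVlt.
  case: eqP => [-> _ x nU|_ /= jJ]; first exact: g0.
  exact: f0.
- by move=> j x; case: eqP => // _; have /andP[] := g01 x.
- move=> x Fx; have [gx|gx] := leP (g x) (1 / 2); last first.
    by exists J => //; rewrite eqxx ltW.
  have [//|j jJ fj] := fF x; exists j; first exact: ltnW.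
  by rewrite ltn_eqF.
Qed.

Lemma partition_of_unity (J : nat) (F : set X) (U : nat -> set X) : closed F ->
  (forall j, (j < J)%N -> open (U j)) ->
  F `<=` \bigcup_(j in [set j | (j < J)%N]) U j ->
  exists (K : nat -> set X) (h : nat -> X -> R),
    [/\ forall j, (j < J)%N -> closed (K j) /\ K j `<=` U j,
      forall j, continuous (h j), forall j x, 0 <= h j x,
      forall j x, ~ K j x -> h j x = 0 &
      forall x, F x -> \sum_(j < J) h j x = 1].
Proof.
move=> clF oU FU; have [f [cf f0 fge fF]] := subordinate_functions clF oU FU.
pose g j x := Num.max (f j x - 1 / 4) 0.
have cg j : continuous (g j).
  exact: max_continuous (subr_cst_continuous (cf j)) (@cst_continuous _ _ 0).
have g_ge0 j x : 0 <= g j x by rewrite le_max lexx orbT.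
pose s x := Num.max (\sum_(j < J) g j x) (1 / 4).
have cs : continuous s.
  apply: max_continuous; last exact: cst_continuous.
  by move=> x; apply: cvg_big => // [|j _]; [exact: add_continuous|exact: cg].
have s_gt0 x : 0 < s x by rewrite lt_max orbC divr_gt0.
(* Cutting f j at 1/4 leaves the closed set {f j >= 1/4} inside U j as support,
   while some f j is at least 1/2 on F; the sum of the cut functions is thus at
   least 1/4 on F, so that the lower bound 1/4 built into the denominator s is
   inactive there. *)
exists (fun j => [set x | 1 / 4 <= f j x]), (fun j x => g j x / s x); split.
- move=> j jJ; split.
    apply: (@closed_comp _ _ (f j) [set r | 1 / 4 <= r]) => [x _|].
      exact: cf.
    exact: closed_ge.
  move=> x /= fx; apply: contrapT => /(f0 _ jJ) fx0.
  by move: fx; rewrite fx0; lra.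
- move=> j x; apply: cvgM; first exact: cg.
  by apply: cvgV; [rewrite gt_eqF|exact: cs].
- by move=> j x; rewrite divr_ge0// ltW.
- move=> j x /= /negP; rewrite -ltNge => fx.
  by rewrite /g max_r ?mul0r// subr_le0 ltW.
- move=> x /fF[j jJ fj]; have sum_ge : 1 / 4 <= \sum_(j < J) g j x.
    rewrite (bigD1 (Ordinal jJ))//= ler_wpDr ?sumr_ge0// /g le_max.
    by apply/orP; left; lra.
  by rewrite -mulr_suml /s max_l// divff// gt_eqF// (lt_le_trans _ sum_ge).
Qed.

End compact_hausdorff.

(** * Matrices over the crossed product and r-normalizers *)

Section crossed_product_closure.
Variables (R : realType) (G : groupType) (X : topologicalType).
Variables (Xcompact : compact [set: X]) (al : taction G X).
Local Notation C := (Cx R).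
Local Notation H := (l2 R (G * X)%type).
Local Notation B := (bop R (G * X)%type).
Local Notation mulop := (mulop Xcompact al).
Local Notation transop := (@transop R G X).
Local Notation algebraic := (@algebraic_crossed_product R G X Xcompact al).
Local Notation crossed := (@crossed_product R G X Xcompact al).
Local Notation diagop := (diagop Xcompact al).
Local Notation RN n := (r_normalizers (mx_crossed_product R Xcompact al n)
                          (diag_subalgebra R Xcompact al n)).

Lemma algebraic_crossed (T : B) : algebraic T -> crossed T.
Proof.
move=> aT e e0; exists T => //; apply: le_lt_trans e0.
apply: opnorm_le => xi _; rewrite subrr.
by rewrite (_ : (0 : B) xi = 0)// l2norm0.
Qed.

Lemma sandwichE n (t : 'M[B]_n) (d : 'I_n -> cfun R X) i j :
  (mxadj t *m diagop d *m t) i j = \sum_k adj (t k i) * mulop (d k) * t k j.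
Proof.
rewrite mxE; apply: eq_bigr => k _; rewrite mul_mx_diag !mxE.
by [].
Qed.

Lemma diagopE n (d : 'I_n -> cfun R X) i j :
  diagop d i j = mulop (d i) *+ (i == j).
Proof. by rewrite !mxE. Qed.

Lemma mulop_delta f p : mulop f (delta R p) = f (al p.1 p.2) *: delta R p.
Proof.
apply: l2P => q; rewrite mulopE l2Z deltaE.
by have [->|_] := eqVneq q p; rewrite ?mulr0.
Qed.

Lemma le_vnorm n (xi : 'I_n -> H) k : l2norm (xi k) <= vnorm xi.
Proof.
rewrite -[leLHS]ger0_norm ?l2norm_ge0// -sqrtr_sqr ler_wsqrtr//.
by rewrite (bigD1 k)//= lerDl sumr_ge0// => l _; exact: sqr_ge0.
Qed.

Lemma vnorm_mxapply_le n (t : 'M[B]_n) xi :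
  vnorm xi <= 1 -> vnorm (mxapply t xi) <= mxopnorm t.
Proof.
pose ball := [set xi : 'I_n -> H | vnorm xi <= 1].
have ballP zeta k : ball zeta -> l2norm (zeta k) <= 1.
  exact/le_trans/le_vnorm.
have rowP k (s : seq 'I_n) : exists M : R, forall xi, ball xi ->
    l2norm (\sum_(l <- s) t k l (xi l)) <= M.
  elim: s => [|l s [M sM]].
    by exists 0 => zeta _; rewrite big_nil l2norm0.
  have [N N0 tN] := bop_pos_bound (t k l).
  exists (2 * N + 2 * M) => zeta bz.
  rewrite big_cons (le_trans (l2normD_le _ _))//.
  rewrite lerD ?ler_pM2l//; last exact: sM.
  by rewrite (le_trans (tN _))// ler_piMr// ballP.
have /choice[M tM] k : exists M : R, forall xi, ball xi ->
    l2norm (\sum_l t k l (xi l)) <= M := rowP k (index_enum 'I_n).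
move=> bxi; apply: ub_le_sup; last by exists xi.
exists (Num.sqrt (\sum_k M k ^+ 2)) => _ [zeta bz <-].
rewrite ler_wsqrtr// ler_sum// => k _; have tk := tM k zeta bz.
by rewrite ler_pXn2r ?nnegrE ?l2norm_ge0// (le_trans _ tk)// l2norm_ge0.
Qed.

Lemma vnorm0 n : vnorm (fun _ : 'I_n => 0 : H) = 0.
Proof. by rewrite /vnorm big1 ?sqrtr0// => k _; rewrite l2norm0 expr0n. Qed.

Lemma mxopnorm_ge0 n (t : 'M[B]_n) : 0 <= mxopnorm t.
Proof.
apply: (le_trans (sqrtr_ge0 _)); apply: (vnorm_mxapply_le t (xi := fun=> 0)).
by rewrite vnorm0.
Qed.

Lemma mxopnorm_le n (t : 'M[B]_n) (c : R) :
  (forall xi, vnorm xi <= 1 -> vnorm (mxapply t xi) <= c) -> mxopnorm t <= c.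
Proof.
move=> tc; apply: ge_sup; last by move=> _ [xi xi1 <-]; exact: tc.
exists (vnorm (mxapply t (fun=> 0))); exists (fun=> 0) => //=.
by rewrite vnorm0.
Qed.

Lemma coef_le_mxopnorm n (t : 'M[B]_n) i j p q :
  cnorm (t i j (delta R p) q) <= mxopnorm t.
Proof.
pose xi (l : 'I_n) : H := if l == j then delta R p else 0.
have xi1 : vnorm xi <= 1.
  rewrite /vnorm (bigD1 j)//= big1 => [|l lj]; last first.
    by rewrite /xi (negPf lj) l2norm0 expr0n.
  rewrite addr0 /xi eqxx sqrtr_sqr ger0_norm ?l2norm_ge0//.
  exact: l2norm_delta.
apply: le_trans (vnorm_mxapply_le t xi1).
have -> : t i j (delta R p) = mxapply t xi i.
  rewrite /mxapply (bigD1 j)//= big1 ?addr0 => [|l lj].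
    by rewrite /xi eqxx.
  by rewrite /xi (negPf lj) bop0.
by rewrite (le_trans (cnorm_le_l2norm _ _))// le_vnorm.
Qed.

Lemma mxopnorm_diag_le n (f g : 'I_n -> cfun R X) (c : R) : 0 <= c ->
  (forall i x, cnorm (f i x - g i x) <= c) ->
  mxopnorm (diagop f - diagop g) <= c.
Proof.
move=> c0 fgc; apply: mxopnorm_le => xi xi1.
rewrite -[leRHS]mulr1; apply: le_trans (ler_wpM2l c0 xi1).
rewrite /vnorm -[c in leRHS]ger0_norm// -sqrtr_sqr -sqrtrM ?sqr_ge0//.
rewrite ler_wsqrtr// mulr_sumr ler_sum// => i _.
rewrite -exprMn ler_pXn2r ?nnegrE ?mulr_ge0 ?l2norm_ge0//.
apply: l2norm_le => //; apply: sqsum_le => [|p]; rewrite ?sqr_ge0//.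
rewrite (_ : mxapply _ xi i p = (f i (al p.1 p.2) - g i (al p.1 p.2)) * xi i p).
  rewrite cnormM exprMn ler_wpM2r ?sqr_ge0//.
  by rewrite ler_pXn2r ?nnegrE ?cnorm_ge0.
rewrite /mxapply l2_sumE (bigD1 i)//= big1 => [|j ji].
  by rewrite !mxE eqxx !mulr1n addr0 mulrBl.
by rewrite !mxE eq_sym (negPf ji) !mulr0n subrr.
Qed.

Lemma crossed_mulop (h : cfun R X) (T : B) : crossed T -> crossed (mulop h * T).
Proof.
move=> cT e e0; have [M M0 hM] := cfun_bounded Xcompact h.
have K0 : 0 < M + 1 by rewrite ltr_wpDl.
have [S [l defS] TS] := cT _ (divr_gt0 e0 K0).
have hf_cont (f : cfun R X) : continuous (fun x => h x * f x : C).
  by move=> x; apply: cvgM; exact: cts_fun.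
exists (mulop h * S).
  exists [seq (mkcts (hf_cont p.1) : cfun R X, p.2) | p <- l].
  rewrite defS big_map mulr_sumr; apply: eq_bigr => p _ /=.
  apply: bopP => xi; apply: l2P => q; exact: mulrA.
rewrite -mulrBr.
apply: (@le_lt_trans _ _ (M * opnorm (T - S))).
  apply: opnorm_le => xi xi1.
  apply: (le_trans (l2norm_mulop_le Xcompact al ((T - S) xi) M0 hM)).
  by rewrite ler_wpM2l// le_opnorm.
have := TS; rewrite ltr_pdivlMr// mulrC; apply: le_lt_trans.
rewrite ler_wpM2r ?lerDl//.
by rewrite (le_trans _ (le_opnorm _ (_ : l2norm 0 <= 1))) ?l2norm_ge0 ?l2norm0.
Qed.

Lemma diagopM n (f g h : 'I_n -> cfun R X) :
  (forall i x, f i x * g i x = h i x) -> diagop f *m diagop g = diagop h.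
Proof.
move=> fg; apply/matrixP => i j; rewrite mul_mx_diag !mxE.
have [<-|_] := eqVneq i j; last by rewrite !mulr0n mul0r.
rewrite !mulr1n; apply: bopP => xi; apply: l2P => p.
by rewrite /= mulrA fg.
Qed.

Lemma mxadj_diagM n (h : 'I_n -> cfun R X) (t : 'M[B]_n) :
  (forall i x, (h i x)^* = h i x) ->
  mxadj (diagop h *m t) = mxadj t *m diagop h.
Proof.
move=> hR; apply/matrixP => i j; rewrite mul_mx_diag mul_diag_mx !mxE.
by rewrite adjM adj_mulop.
Qed.

(** Multiplying on the left by a diagonal h replaces d by h d h. *)
Lemma RN_diagM n (h : 'I_n -> cfun R X) (t : 'M[B]_n) :
  (forall i x, (h i x)^* = h i x) -> RN n t -> RN n (diagop h *m t).
Proof.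
move=> hR [ct tDt]; split=> [i j|_ [d _ <-]].
  by rewrite mul_diag_mx !mxE; exact/crossed_mulop/ct.
rewrite mxadj_diagM// (_ : _ *m _ =
  mxadj t *m (diagop h *m diagop d *m diagop h) *m t); last by rewrite !mulmxA.
apply: tDt.
have dc i : continuous (fun x => h i x * d i x * h i x : C).
  by move=> x; apply: cvgM; [apply: cvgM|]; exact: cts_fun.
exists (fun i => mkcts (dc i)) => //; apply/esym.
have hd_c i : continuous (fun x => h i x * d i x : C).
  by move=> x; apply: cvgM; exact: cts_fun.
by rewrite (@diagopM _ _ _ (fun i => mkcts (hd_c i)))//; exact: diagopM.
Qed.

Section rows.
Hypotheses (Xhausdorff : hausdorff_space X) (al_free : free_taction al).

Lemma free_action_inj s s' x : al s x = al s' x -> s = s'.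
Proof.
move=> e; apply: (@mulgI _ s'^-1%g); rewrite mulVg; apply: (al_free (x := x)).
by rewrite tactionM e -tactionM mulVg taction1.
Qed.

(** Let p = (s, x), with s x = y. A bump function at y that vanishes at the
    other points of the orbit carrying the bulk of u' isolates the coordinate p:
    by freeness these points are different from y. What remains is the tail of
    u', which is arbitrarily small in norm. *)
Lemma orthogonal_disjoint_on_fiber (u u' : H) x :
  (forall s y, y <> x -> u' (s, y) = 0) ->
  (forall (f : X -> R) (cf : continuous f),
    inner u (mulop (real_cfun cf) u') = 0) ->
  forall s, u (s, x) * (u' (s, x))^* = 0.
Proof.
move=> u'x orth s; apply: cnorm_arb_small => e e0.
set p := (s, x).
have K0 : 0 < l2norm u + 1 by rewrite ltr_wpDl ?l2norm_ge0.
(* J carries u' up to a small error; bad lists the points of the orbit of x,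
   other than s x, at which the bump function has to vanish. *)
have [J pJ Je] := trunc_approx u' [fset p]%fset (divr_gt0 e0 K0).
rewrite fsub1set in pJ.
pose bad := [seq al q.1 q.2 | q <- J & (q != p) && (q.2 == x)].
have pbad : al s x \notin bad.
  apply/negP => /mapP[[s' x']].
  rewrite mem_filter /= => /andP[/andP[/eqP qp /eqP x'x] _].
  rewrite x'x in qp *.
  by move=> /free_action_inj ss'; apply: qp; rewrite /p ss'.
have [f [cf f01 f0 f1]] := bump_fun R Xcompact Xhausdorff pbad.
have trE : mulop (real_cfun cf) (trunc J u') = u' p *: delta R p.
  apply: l2P => q; rewrite mulopE truncE l2Z deltaE real_cfunE.
  have [->|qp] := eqVneq q p; first by rewrite f1 pJ mul1r mulr1.
  rewrite mulr0; case: ifPn => qJ; last by rewrite mulr0.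
  have [qx|/eqP qx] := eqVneq q.2 x; last first.
    by case: q {qp qJ} qx => s' x' /= x'x; rewrite u'x ?mulr0.
  rewrite f0 ?mul0r//; apply/mapP; exists q => //.
  by rewrite mem_filter qp qx eqxx.
have small : inner u (mulop (real_cfun cf) (u' - trunc J u')) =
    - (u p * (u' p)^*).
  rewrite bopB trE innerBr orth sub0r innerZr inner_conj inner_delta conjCK.
  by rewrite mulrC.
rewrite -[cnorm _](_ : cnorm (- (u p * (u' p)^*)) = _); last first.
  by rewrite /cnorm normrN.
rewrite -small (le_trans (cnorm_inner_le _ _))//.
apply: (@le_trans _ _ ((l2norm u + 1) * (e / (l2norm u + 1)))); last first.
  by rewrite mulrC divfK// gt_eqF.
rewrite ler_pM ?l2norm_ge0 ?lerDl//; apply: le_trans Je.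
rewrite -[leRHS]mul1r; apply: l2norm_mulop_le => // y.
by rewrite real_cfunE cnormC; have /andP[fy0 fy1] := f01 y; rewrite ger0_norm.
Qed.

(** Row (i, s x) of t has at most one nonzero entry: the columns (j, r x) and
    (j', r' x) of t remain orthogonal when multiplied in the i-th block by any
    continuous function, because the entry of adj t d t that they produce is off
    the diagonal. *)
Lemma RN_row_unique n (t : 'M[B]_n) i j j' s r r' x :
  RN n t -> (j, r) <> (j', r') ->
  t i j (delta R (r, x)) (s, x) = 0 \/ t i j' (delta R (r', x)) (s, x) = 0.
Proof.
move=> [ct tDt] jr.
suff /eqP : t i j (delta R (r, x)) (s, x) *
    (t i j' (delta R (r', x)) (s, x))^* = 0.
  by rewrite mulf_eq0 conjC_eq0 => /orP[]/eqP; [left|right].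
apply: orthogonal_disjoint_on_fiber => [s0 y yx|f cf].
  exact: coef_support.
pose d (k : 'I_n) : cfun R X :=
  if k == i then real_cfun cf else real_cfun (@cst_continuous _ _ (0 : R)).
have [|c _ /matrixP/(_ j j')] := tDt (diagop d); first by exists d.
rewrite sandwichE diagopE.
move=> /(congr1 (fun T : B => T (delta R (r', x)) (r, x))).
rewrite bop_sumE l2_sumE (bigD1 i)//= big1 => [|k ki]; last first.
  rewrite adj_coef /d (negPf ki).
  rewrite [X in inner _ X](_ : _ = 0) ?inner0r ?conjC0//.
  by apply: l2P => q; exact: mul0r.
rewrite addr0 adj_coef /d eqxx => e.
apply: (can_inj (@conjCK C)); rewrite conjC0 -{}e.
have [jj'|_] := eqVneq j j'; last by [].
rewrite mulr1n mulop_delta l2Z deltaE (_ : (_ == _) = false) ?mulr0//.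
by apply/eqP => -[rr']; apply: jr; rewrite jj' rr'.
Qed.

End rows.
End crossed_product_closure.

(** * Approximation by r-normalizers implies comparison *)

Section comparison_from_approximation.
Variables (R : realType) (G : groupType) (X : topologicalType).
Variables (Xcompact : compact [set: X]) (al : taction G X).
Hypotheses (Xhausdorff : hausdorff_space X) (al_free : free_taction al).
Local Notation C := (Cx R).
Local Notation B := (bop R (G * X)%type).
Local Notation diagop := (diagop Xcompact al).
Local Notation RN n := (r_normalizers (mx_crossed_product R Xcompact al n)
                          (diag_subalgebra R Xcompact al n)).

Lemma open_support (f : X -> C) : continuous f -> open [set x | f x != 0].
Proof.
move=> cf; rewrite (_ : [set x | _] =
  (fun x => cnorm (f x)) @^-1` [set r | 0 < r]).
  apply: open_comp; last exact: open_gt.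
  by move=> x _; apply: (continuous_comp (cf x)); exact: cnorm_continuous.
apply/seteqP; split => x /=; rewrite lt0r cnorm_ge0 andbT; apply: contra_neq.
  exact: cnorm_eq0.
by move=> ->; rewrite cnorm0.
Qed.

(** c_j z is the sum over i of the inner products of u and b_i u, where u is the
    column of t_ij at z; if no g and i were as stated, every summand of these
    would vanish. *)
Lemma nonzero_diag_support n (t : 'M[B]_n) (b c : 'I_n -> cfun R X) j z :
  mx_crossed_product R Xcompact al n t ->
  mxadj t *m diagop b *m t = diagop c -> c j z != 0 ->
  exists i g, b i (al g z) != 0 /\ t i j (delta R (1%g, z)) (g, z) != 0.
Proof.
move=> ct /matrixP/(_ j j); rewrite sandwichE diagopE eqxx mulr1n => tbt cjz.
apply: contrapT => no; move/eqP: cjz; apply.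
move/(congr1 (fun T : B => T (delta R (1%g, z)) (1%g, z))): tbt.
rewrite mulop_delta l2Z deltaE eqxx mulr1 /= taction1 => <-.
rewrite bop_sumE l2_sumE big1// => i _; rewrite adj_coef.
set u := t i j _.
rewrite inner_disjoint ?conjC0// => -[g y] /=.
have [->|/eqP yz] := eqVneq y z; last first.
  by rewrite /u (coef_support _ _ (ct i j) yz) mul0r.
have [->|u0] := eqVneq (u (g, z)) 0; first by rewrite mul0r.
rewrite (_ : b i (al g z) = 0) ?mul0r ?conjC0 ?mulr0//.
by apply/eqP; apply: contrapT => /negP b0; apply: no; exists i, g.
Qed.

(** The open sets are V j (i, g) = {z | b_i (g z) and the coefficient of t from
    (z, j) to (g z, i) are nonzero}, translated by g into the i-th copy. If two
    translates meet, a row of t has two nonzero entries, so they come from the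
    same column and the same g. *)
Lemma approx_diag_precsim n (a b : 'I_n -> cfun R X) :
  (forall e : R, 0 < e -> exists2 t : 'M[B]_n, RN n t &
     mxopnorm (mxadj t *m diagop b *m t - diagop a) < e) ->
  diag_precsim al a b.
Proof.
move=> approx F cF Fa.
have acont i : continuous (fun x => cnorm (a i x)).
  move=> x; apply: (@continuous_comp _ _ _ (a i) (@cnorm R)).
    exact: cts_fun.
  exact: cnorm_continuous.
have /choice[e e0] i : exists e : R,
    0 < e /\ forall x, F i x -> e <= cnorm (a i x).
  have [x Fx|e e0 ea] := compact_lower_bound (cF i) (acont i); last by exists e.
  rewrite lt0r cnorm_ge0 andbT; apply/eqP => /cnorm_eq0 ax0.
  by move: (Fa i x Fx); rewrite /osupp /= ax0 eqxx.
have [|t RNt tb] := approx (\big[Num.min/1]_i e i).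
  by apply: lt_bigmin => // i _; case: (e0 i).
have [ct tDt] := RNt.
have [|c _ cE] := tDt (diagop b); first by exists b.
rewrite -cE in tb.
have cF0 i x : F i x -> c i x != 0.
  move=> Fx; apply/eqP => cx0.
  have := coef_le_mxopnorm (diagop c - diagop a) i i (1%g, x) (1%g, x).
  rewrite leNgt => /negP; apply.
  rewrite !mxE eqxx !mulr1n.
  rewrite (_ : _ (1%g, x) = c i x - a i x); last first.
    rewrite -[_ (delta _ _)]/(mulop Xcompact al (c i) _ -
      mulop Xcompact al (a i) _).
    by rewrite !mulop_delta l2B !l2Z deltaE eqxx !mulr1 /= taction1.
  apply: (lt_le_trans tb); rewrite cx0 sub0r /cnorm normrN -/(cnorm _).
  have [_ /(_ x Fx)] := e0 i; apply: le_trans.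
  exact: bigmin_le.
pose V j (k : 'I_n * G) : set X := [set z | b k.1 (al k.2 z) != 0] `&`
  [set z | t k.1 j (delta R (1%g, z)) (k.2, z) != 0].
have oV j k : open (V j k).
  apply: openI; apply: open_support.
    move=> z; apply: (@continuous_comp _ _ _ (al k.2) (b k.1)).
      exact: taction_continuous.
    exact: cts_fun.
  exact: coef_continuous.
have /choice[D FD] j : exists D : {fset 'I_n * G},
    F j `<=` \bigcup_(k in [set` D]) V j k.
  apply: compact_fset_cover => // z /cF0 cz.
  have [i [g [bz tz]]] := nonzero_diag_support ct (esym cE) cz.
  by exists (i, g).
pose k j m := nth (j, 1%g) (D j) m.
exists (fun j => size (D j)), (fun j m => V j (k j m)), (fun j m => (k j m).2),
  (fun j m => (k j m).1) => idx W.
split.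
- by move=> p _; exact: oV.
- move=> j z /FD[km /= kD Vz]; exists (index km (D j)).
    by rewrite /= index_mem.
  by rewrite /k nth_index.
- by move=> p _ [y l] [/= [z [bz tz] <-] ->].
- move=> [j m] [j' m'] /= ip ip'.
  move=> [[y l] [[/= [z [_ tz] zy] lE] [/= [z' [_ tz'] zy'] lE']]].
  move: tz tz' zy zy' lE lE'.
  rewrite /idx /= in ip ip'.
  case Ek : (k j m) => [i s]; case Ek' : (k j' m') => [i' s'] /=.
  move=> tz tz' zy zy' li li'; subst i i'.
  have z'E : z' = al (s'^-1 * s)%g z.
    by rewrite tactionM zy -zy' -tactionM mulVg taction1.
  (* Seen from the base point z, the two entries sit in the columns (j, 1) and
     (j', s'^-1 s) of the row (l, s z). *)
  have [[jj' ss']|neq] := pselect ((j, 1%g) = (j', (s'^-1 * s)%g)).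
    subst j'; have sE : s = s' by apply: (@mulgI _ s'^-1%g); rewrite -ss' mulVg.
    congr (_, _); apply/eqP; rewrite -(nth_uniq (j, 1%g) ip ip') ?fset_uniq//.
    by rewrite -!/(k _ _) Ek Ek' sE.
  have := RN_row_unique Xhausdorff al_free l s z RNt neq.
  rewrite (coef_translate (s'^-1 * s)%g _ _ (ct _ _)) -z'E invgM invgK mulVKg.
  by case=> e1; move: tz tz'; rewrite e1 eqxx.
Qed.

End comparison_from_approximation.

(** * Constructing r-normalizers *)

Section construction.
Variables (R : realType) (G : groupType) (X : topologicalType).
Variables (Xcompact : compact [set: X]) (al : taction G X).
Local Notation C := (Cx R).
Local Notation H := (l2 R (G * X)%type).
Local Notation B := (bop R (G * X)%type).
Local Notation mulop := (mulop Xcompact al).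
Local Notation transop := (@transop R G X).
Local Notation diagop := (diagop Xcompact al).
Local Notation RN n := (r_normalizers (mx_crossed_product R Xcompact al n)
                          (diag_subalgebra R Xcompact al n)).

Lemma ge0_Re (z : C) : 0 <= z -> z = ((complex.Re z)%:C)%C.
Proof. by move=> z0; rewrite RRe_real// realE z0. Qed.

Lemma Re_gt0 (z : C) : 0 <= z -> z != 0 -> 0 < complex.Re z.
Proof. by move=> z0 zn0; rewrite -ltcR -ge0_Re// lt0r zn0. Qed.

Lemma cutoffE (f : cfun R X) (e : R) x :
  cutoff f e x = ((Num.max (complex.Re (f x) - e) 0)%:C)%C.
Proof. by []. Qed.

Lemma cutoff_close (f : cfun R X) (e : R) x : 0 <= f x -> 0 <= e ->
  cnorm (cutoff f e x - f x) <= e.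
Proof.
move=> f0 e0; rewrite [f x in X in cnorm X]ge0_Re// cutoffE -rmorphB/= cnormC.
have : 0 <= complex.Re (f x) by rewrite -lecR -ge0_Re.
rewrite ler_norml; case: (leP (complex.Re (f x) - e) 0) => ? ?;
  by apply/andP; split; lra.
Qed.

(** t' = h t with h b h = (b - delta)_+. The denominator of h is max (b, delta)
    instead of b to keep h continuous; the two agree where (b - delta)_+ is not
    zero. *)
Lemma RN_absorb_cutoff n (b : 'I_n -> cfun R X) (delta : R) (t : 'M[B]_n) :
  0 < delta -> (forall i x, 0 <= b i x) -> RN n t ->
  exists2 t', RN n t' &
    mxadj t' *m diagop b *m t' =
    mxadj t *m diagop (fun i => cutoff (b i) delta) *m t.
Proof.
move=> d0 b0 RNt.
pose h i x := Num.sqrt (Num.max (complex.Re (b i x) - delta) 0 /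
                        Num.max (complex.Re (b i x)) delta).
have den0 i x : 0 < Num.max (complex.Re (b i x)) delta.
  by rewrite lt_max d0 orbT.
have ch i : continuous (h i).
  move=> x; apply: continuous_comp; last exact: sqrt_continuous.
  apply: cvgM.
    exact: max_continuous (subr_cst_continuous (@Re_cfun_continuous _ _ (b i)))
      (@cst_continuous _ _ 0) x.
  apply: cvgV; first by rewrite gt_eqF.
  exact: max_continuous (@Re_cfun_continuous _ _ (b i))
    (@cst_continuous _ _ delta) x.
pose hc i := real_cfun (ch i).
have hR i x : (hc i x)^* = hc i x by exact: conj_real_cfun.
exists (diagop hc *m t); first exact: RN_diagM.
rewrite mxadj_diagM// (_ : _ *m _ =
  mxadj t *m (diagop hc *m diagop b *m diagop hc) *m t); last first.
  by rewrite !mulmxA.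
have hb_c i : continuous (fun x => hc i x * b i x : C).
  by move=> x; apply: cvgM; exact: cts_fun.
rewrite (@diagopM _ _ _ _ _ _ _ _ (fun i => mkcts (hb_c i)))//.
congr (_ *m _ *m _); apply: diagopM => i x.
rewrite [LHS](_ : _ = hc i x * b i x * hc i x)// cutoffE real_cfunE.
rewrite [b i x]ge0_Re// -!rmorphM/=; congr (_%:C)%C.
rewrite mulrAC -expr2 sqr_sqrtr; last first.
  by apply: divr_ge0; [rewrite le_max lexx orbT|exact: ltW].
have [bd|bd] := leP (complex.Re (b i x)) delta.
  by rewrite max_r ?mul0r// subr_le0.
by rewrite divfK// gt_eqF// (lt_trans d0).
Qed.

Lemma transop_mulop (f : X -> R) (cf : continuous f) g
    (cfg : continuous (fun x => f (al g^-1%g x))) :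
  transop g * mulop (real_cfun cf) = mulop (real_cfun cfg) * transop g.
Proof.
apply: bopP => xi; apply: l2P => p.
transitivity (((f (al (g^-1 * p.1)%g p.2))%:C)%C *
  xi (g^-1 * p.1, p.2)%g) => //.
by rewrite tactionM.
Qed.

Lemma mulop_sum (K : finType) (c : cfun R X) (f : K -> cfun R X) :
  (forall x, c x = \sum_k f k x) -> mulop c = \sum_k mulop (f k).
Proof.
move=> cE; apply: bopP => xi; apply: l2P => p.
by rewrite bop_sumE l2_sumE mulopE cE mulr_suml.
Qed.

Section sum_of_translates.
Variables (n : nat) (J : 'I_n -> nat) (q : 'I_n -> nat -> X -> R).
Hypothesis cq : forall i j, continuous (q i j).
Variables (s : 'I_n -> nat -> G) (k : 'I_n -> nat -> 'I_n).
Hypothesis disj : forall i j i' j' x x', (j < J i)%N -> (j' < J i')%N ->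
  k i j = k i' j' -> al (s i j) x = al (s i' j') x' ->
  q i j x <> 0 -> q i' j' x' <> 0 -> (i, j) = (i', j').

Lemma square_translate_continuous i j (d : cfun R X) :
  continuous (fun x => ((q i j x ^+ 2)%:C)%C * d (al (s i j) x) : C).
Proof.
move=> x; apply: cvgM.
  apply: (@continuous_comp _ _ _ (fun x => q i j x ^+ 2)
    (fun r : R => (r%:C)%C : C)); last exact: complex_of_real_continuous.
  by apply: cvgM; exact: cq.
apply: (@continuous_comp _ _ _ (al (s i j)) d); last exact: cts_fun.
exact: taction_continuous.
Qed.

Let qc i j : cfun R X := real_cfun (cq (i := i) (j := j)).

(** lambda_s q, the operator that moves the function q from its support to the
    translate of the support by s. The matrix [translates] collects them: the
    j-th function for column i is placed in row k i j. *)
Definition translate i j : B := transop (s i j) * mulop (qc i j).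

Definition translates : 'M[B]_n :=
  \matrix_(l, i) \sum_(j < J i | k i j == l) translate i j.

Lemma adj_translate i j :
  adj (translate i j) = mulop (qc i j) * transop (s i j)^-1%g.
Proof. by rewrite adjM adj_transop adj_mulop// => x; exact: conj_real_cfun. Qed.

Lemma translate_sandwich i j i' j' (d : cfun R X) xi p :
  (adj (translate i j) * mulop d * translate i' j') xi p =
  ((q i j (al p.1 p.2))%:C)%C * (d (al (s i j) (al p.1 p.2)) *
   (((q i' j' (al ((s i' j')^-1 * s i j)%g (al p.1 p.2)))%:C)%C *
     xi ((s i' j')^-1 * (s i j * p.1), p.2)%g)).
Proof.
rewrite adj_translate.
transitivity (((q i j (al p.1 p.2))%:C)%C *
  (d (al ((s i j)^-1^-1 * p.1)%g p.2) *
   (((q i' j' (al ((s i' j')^-1 * ((s i j)^-1^-1 * p.1))%g p.2))%:C)%C *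
     xi ((s i' j')^-1 * ((s i j)^-1^-1 * p.1), p.2)%g))) => //.
by rewrite invgK -!tactionM !mulgA.
Qed.

(** The two functions are multiplied at points that their translations send to
    the same point; [disj] forbids that both points lie in the supports. *)
Lemma translate_orthogonal i j i' j' (d : cfun R X) :
  (j < J i)%N -> (j' < J i')%N -> k i j = k i' j' -> (i, j) <> (i', j') ->
  adj (translate i j) * mulop d * translate i' j' = 0.
Proof.
move=> jJ jJ' kk' neq; apply: bopP => xi; apply: l2P => p.
rewrite translate_sandwich; set x := al p.1 p.2; set x' := al (_ * _)%g x.
have [->|/eqP qx] := eqVneq (q i j x) 0; first by rewrite mul0r.
have [->|/eqP qx'] := eqVneq (q i' j' x') 0; first by rewrite mul0r !mulr0.
case: neq; apply: (disj jJ jJ' kk' _ qx qx').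
by rewrite /x' -tactionM mulVKg.
Qed.

Lemma translate_square i j (d c : cfun R X) :
  (forall x, c x = ((q i j x ^+ 2)%:C)%C * d (al (s i j) x)) ->
  adj (translate i j) * mulop d * translate i j = mulop c.
Proof.
move=> cE; apply: bopP => xi; apply: l2P => p.
rewrite translate_sandwich mulVg taction1 mulKg -surjective_pairing mulopE cE.
by rewrite rmorphXn/= expr2; ring.
Qed.

Lemma translates_crossed : mx_crossed_product R Xcompact al n translates.
Proof.
move=> l i; rewrite mxE; apply: algebraic_crossed.
have cqs j : continuous (fun x => q i j (al (s i j)^-1%g x)).
  move=> x; apply: (@continuous_comp _ _ _ (al (s i j)^-1%g) (q i j)).
    exact: taction_continuous.
  exact: cq.
exists (map (fun j : 'I_(J i) => (real_cfun (cqs j) : cfun R X, s i j))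
  [seq j : 'I_(J i) <- index_enum 'I_(J i) | k i j == l]).
rewrite big_map big_filter; apply: eq_bigr => j _.
exact: transop_mulop.
Qed.

Lemma translates_sandwich (d c : 'I_n -> cfun R X) :
  (forall i x, c i x = \sum_(j < J i)
     ((q i j x ^+ 2)%:C)%C * d (k i j) (al (s i j) x)) ->
  mxadj translates *m diagop d *m translates = diagop c.
Proof.
move=> cE; apply/matrixP => i i'; rewrite sandwichE diagopE.
have expand l : adj (translates l i) * mulop (d l) * translates l i' =
    \sum_(j < J i | k i j == l) \sum_(j' < J i' | k i' j' == l)
      adj (translate i j) * mulop (d (k i j)) * translate i' j'.
  rewrite !mxE adj_sum mulr_suml mulr_suml; apply: eq_bigr => j /eqP ->.
  by rewrite mulr_sumr.
under eq_bigr do rewrite expand.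
have [ii'|/eqP ii'] := eqVneq i i'; last first.
  rewrite big1// => l _; rewrite big1// => j /eqP kj.
  rewrite big1// => j' /eqP kj'.
  by apply: translate_orthogonal => //; [rewrite kj kj'|case].
subst i'; rewrite mulr1n.
have dc j := @square_translate_continuous i j (d (k i j)).
rewrite (@mulop_sum _ (c i) (fun j : 'I_(J i) => mkcts (dc j))); last exact: cE.
rewrite [RHS](partition_big (fun j : 'I_(J i) => k i j) xpredT)//=.
apply: eq_bigr => l _; apply: eq_bigr => j /eqP kj.
rewrite (bigD1 j); last by rewrite kj.
rewrite big1; first by apply: etrans (addr0 _) _; exact: translate_square.
move=> j' /andP[/eqP kj' j'j].
apply: translate_orthogonal => //; first by rewrite kj kj'.
by case=> /val_inj jj'; rewrite jj' eqxx in j'j.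
Qed.

Lemma translates_RN : RN n translates.
Proof.
split=> [|_ [d _ <-]]; first exact: translates_crossed.
have cc i : continuous (fun x => \sum_(j < J i)
     ((q i j x ^+ 2)%:C)%C * d (k i j) (al (s i j) x) : C).
  move=> x; apply: cvg_big => [|j _]; first exact: add_continuous.
  exact: square_translate_continuous.
by exists (fun i => mkcts (cc i)) => //; apply/esym/translates_sandwich.
Qed.

End sum_of_translates.
End construction.

(** * The equivalence *)

(** The square root q_ij of (a_i - eps)_+ h_ij / (b_k (s x) - delta) solves
    sum_j q_ij^2 (b_k (s x) - delta)_+ = (a_i - eps)_+, as the h_ij add up to 1
    where a_i > eps. *)
Lemma precsim_cutoff_sandwich (R : realType) (G : groupType)
    (X : topologicalType)
    (Xcompact : compact [set: X]) (Xhausdorff : hausdorff_space X)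
    (al : taction G X) n (a b : 'I_n -> cfun R X)
    (b_ge0 : forall i x, 0 <= b i x) (eps : R) :
  0 < eps -> diag_precsim al a b ->
  exists (delta : R) (t : 'M[bop R (G * X)%type]_n),
    [/\ 0 < delta, r_normalizers (mx_crossed_product R Xcompact al n)
                     (diag_subalgebra R Xcompact al n) t &
      mxadj t *m diagop Xcompact al (fun i => cutoff (b i) delta) *m t
      = diagop Xcompact al (fun i => cutoff (a i) eps)].
Proof.
move=> eps0 ab.
pose F i := [set x | eps <= complex.Re (a i x)].
have clF i : closed (F i).
  apply: (@closed_comp _ _ (fun x => complex.Re (a i x)) [set r | eps <= r]).
    by move=> x _; exact: Re_cfun_continuous.
  exact: closed_ge.
have [i|i x aix|J [U [s [k [oU FU sub triv]]]]] := ab F.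
- exact: subclosed_compact (clF i) Xcompact _.
- by apply/eqP => ax0; move: aix; rewrite /F /mkset ax0 leNgt eps0.
have oUi i j : (j < J i)%N -> open (U i j) by move=> jJ; exact: (oU (i, j)).
have /choice[K /choice[h KhP]] (i : 'I_n) :=
  partition_of_unity R Xcompact Xhausdorff (clF i) (oUi i) (FU i).
pose bs i j x := complex.Re (b (k i j) (al (s i j) x)).
have cbs i j : continuous (bs i j).
  move=> x; apply: (@continuous_comp _ _ _ (al (s i j))
    (fun x => complex.Re (b (k i j) x))).
    exact: taction_continuous.
  exact: Re_cfun_continuous.
have /choice[e eP] (p : 'I_n * nat) : exists e : R, 0 < e /\
    ((p.2 < J p.1)%N -> forall x, K p.1 p.2 x -> e <= bs p.1 p.2 x).
  have [jJ|_] := boolP (p.2 < J p.1)%N; last by exists 1.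
  have [KU _ _ _ _] := KhP p.1; have [clK subK] := KU _ jJ.
  have cK : compact (K p.1 p.2) by exact: subclosed_compact clK Xcompact _.
  have [x Kx|r r0 rb] := compact_lower_bound cK (cbs p.1 p.2); last by exists r.
  apply: Re_gt0 => //; have := sub p jJ (al (s p.1 p.2) x, k p.1 p.2).
  by apply; split => //=; exists x => //; exact: subK.
(* Half of the lower bound of all b_k (s x) on the supports K i j, so that
   b_k (s x) - delta stays at least delta there. *)
pose delta := (\big[Num.min/1]_i \big[Num.min/1]_(j < J i) e (i, val j)) / 2.
have d0 : 0 < delta.
  rewrite divr_gt0//; apply: lt_bigmin => // i _; apply: lt_bigmin => // j _.
  by case: (eP (i, val j)).
have bs_ge i j x : (j < J i)%N -> K i j x -> delta <= bs i j x - delta.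
  move=> jJ Kx; suff : delta * 2 <= bs i j x by lra.
  rewrite divfK//; have [_ /(_ jJ x Kx)] := eP (i, j); apply: le_trans.
  apply: (@le_trans _ _ (\big[Num.min/1]_(j < J i) e (i, val j))).
    exact: (bigmin_le 1 i (fun i => \big[Num.min/1]_(j < J i) e (i, val j))).
  exact: (bigmin_le 1 (Ordinal jJ) (fun j => e (i, val j))).
(* The maximum with delta makes the quotient continuous and changes nothing on
   the support of h i j. *)
pose q i j x := Num.sqrt (Num.max (complex.Re (a i x) - eps) 0 * h i j x /
  Num.max (bs i j x - delta) delta).
have den0 i j x : 0 < Num.max (bs i j x - delta) delta.
  by rewrite lt_max d0 orbT.
have cq i j : continuous (q i j).
  have [_ ch _ _ _] := KhP i.
  move=> x; apply: continuous_comp; last exact: sqrt_continuous.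
  apply: cvgM.
    apply: cvgM; last exact: ch.
    exact: max_continuous (subr_cst_continuous (@Re_cfun_continuous _ _ (a i)))
      (@cst_continuous _ _ 0) x.
  apply: cvgV; first by rewrite gt_eqF.
  exact: max_continuous (subr_cst_continuous (cbs i j))
    (@cst_continuous _ _ delta) x.
have qK i j x : q i j x <> 0 -> K i j x.
  have [_ _ _ h0 _] := KhP i; move=> qx; apply: contrapT => /h0 hx; apply: qx.
  by rewrite /q hx mulr0 mul0r sqrtr0.
have disj i j i' j' x x' : (j < J i)%N -> (j' < J i')%N ->
    k i j = k i' j' -> al (s i j) x = al (s i' j') x' ->
    q i j x <> 0 -> q i' j' x' <> 0 -> (i, j) = (i', j').
  move=> jJ jJ' kk' xx' /qK Kx /qK Kx'; apply: triv => //.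
  have [/(_ j jJ)[_ KU] _ _ _ _] := KhP i.
  have [/(_ j' jJ')[_ KU'] _ _ _ _] := KhP i'.
  exists (al (s i j) x, k i j); split; split => //=.
    by exists x => //; exact: KU.
  by exists x' => //; exact: KU'.
exists delta, (translates Xcompact al J cq s k); split => //.
  exact: translates_RN.
apply: translates_sandwich => // i x; rewrite cutoffE.
have [_ _ h_ge0 h0 h1] := KhP i.
transitivity (((\sum_(j < J i)
  Num.max (complex.Re (a i x) - eps) 0 * h i j x)%:C)%C : Cx R).
  rewrite -mulr_sumr; have [ax|ax] := leP (complex.Re (a i x) - eps) 0.
    by rewrite mul0r.
  by rewrite h1 ?mulr1// /F /mkset -subr_ge0 ltW.
rewrite rmorph_sum; apply: eq_bigr => j _ /=.
rewrite cutoffE -rmorphM/=; congr (_%:C)%C.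
rewrite /q sqr_sqrtr; last first.
  apply: divr_ge0; last exact: ltW.
  by apply: mulr_ge0; [rewrite le_max lexx orbT|exact: h_ge0].
have [/(bs_ge _ _ _ (ltn_ord j)) bge|/h0 ->] := pselect (K i j x); last first.
  by rewrite mulr0 !mul0r.
rewrite -/(bs i j x) [Num.max (bs i j x - delta) delta]max_l//.
rewrite [Num.max (bs i j x - delta) 0]max_l; last exact: le_trans (ltW d0) bge.
by rewrite divfK// gt_eqF// (lt_le_trans d0).
Qed.

Theorem proposition2p9 (R : realType) (G : groupType) (X : topologicalType)
    (Gcountable : countable [set: G])
    (Xcompact : compact [set: X]) (Xhausdorff : hausdorff_space X)
    (al : taction G X) (al_free : free_taction al)
    (n : nat) (n_ge1 : (1 <= n)%N)
    (a b : 'I_n -> cfun R X)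
    (a_ge0 : forall i x, 0 <= a i x) (b_ge0 : forall i x, 0 <= b i x) :
  let diag := @diagop R G X Xcompact al n in
  let RN := r_normalizers (mx_crossed_product R Xcompact al n)
                          (diag_subalgebra R Xcompact al n) in
  [<-> diag_precsim al a b;
       exists2 t : nat -> 'M[bop R (G * X)%type]_n,
         forall k, RN (t k) &
         (fun k => mxopnorm (mxadj (t k) *m diag b *m t k - diag a))
           @ \oo --> (0 : R);
       forall eps : R, 0 < eps ->
         exists (delta : R) (t : 'M[bop R (G * X)%type]_n),
           [/\ 0 < delta, RN t &
               mxadj t *m diag (fun i => cutoff (b i) delta) *m t
               = diag (fun i => cutoff (a i) eps)]].
Proof.
move=> diag RN.
pose approx := forall e : R, 0 < e -> exists2 t : 'M[bop R (G * X)%type]_n,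
  RN t & mxopnorm (mxadj t *m diag b *m t - diag a) < e.
pose exact_cutoff := forall eps : R, 0 < eps ->
  exists (delta : R) (t : 'M[bop R (G * X)%type]_n), [/\ 0 < delta, RN t &
    mxadj t *m diag (fun i => cutoff (b i) delta) *m t
    = diag (fun i => cutoff (a i) eps)].
have precsim_cutoff : diag_precsim al a b -> exact_cutoff.
  by move=> ab eps eps0; exact: precsim_cutoff_sandwich.
have approx_precsim : approx -> diag_precsim al a b.
  exact: approx_diag_precsim.
have cutoff_approx : exact_cutoff -> approx.
  move=> cut e e0; have e20 : 0 < e / 2 by rewrite divr_gt0.
  have [delta [t [d0 RNt tb]]] := cut _ e20.
  have [t' RNt' t'b] := RN_absorb_cutoff d0 b_ge0 RNt.
  exists t' => //; rewrite /diag t'b -/diag tb.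
  apply: (@le_lt_trans _ _ (e / 2)); last by rewrite gtr_pMr// invf_lt1// ltr1n.
  apply: mxopnorm_diag_le => [|i x]; first exact: ltW.
  by apply: cutoff_close => //; exact: ltW.
have approx_seq : approx <->
    exists2 t : nat -> 'M[bop R (G * X)%type]_n, forall k, RN (t k) &
      (fun k => mxopnorm (mxadj (t k) *m diag b *m t k - diag a))
        @ \oo --> (0 : R).
  split=> [appr|[t RNt t0] e e0].
    have /choice[t tP] (k : nat) : exists t, RN t /\
        mxopnorm (mxadj t *m diag b *m t - diag a) < k.+1%:R^-1.
      by have [//|t RNt tk] := appr k.+1%:R^-1; exists t.
    exists t => [k|]; first by case: (tP k).
    apply: (@squeeze_cvgr _ _ _ _ (fun=> 0) (fun k => k.+1%:R^-1)).
    - near=> k; apply/andP; split; first exact: mxopnorm_ge0.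
      by apply: ltW; case: (tP k).
    - exact: cvg_cst.
    - exact: cvg_harmonic.
  have [k tk] := filter_ex (cvgr0_norm_lt _ t0 e e0).
  by exists (t k) => //; exact: le_lt_trans (ler_norm _) tk.
tfae.
- by move=> /precsim_cutoff/cutoff_approx/approx_seq.
- by move=> /approx_seq/approx_precsim/precsim_cutoff.
- by move=> /cutoff_approx/approx_precsim.
Unshelve. all: by end_near.
Qed.
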